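(* Let $(X,g)$ be a multi-Eguchi--Hanson or a multi-Taub--NUT space whose singular points $p_1,\dots,p_k$ of $\phi$ all lie on a line in $\mathbb{R}^3$. Then there are no compact minimal hypersurfaces in $X$.
   Context: Multi-Eguchi--Hanson and multi-Taub--NUT spaces: let $p_1,\dots,p_k$ be distinct points of $\mathbb{R}^3$ ($k\ge 1$), let $m\ge 0$, let $U=\mathbb{R}^3\setminus\{p_1,\dots,p_k\}$, and let $\phi(x)=m+\sum_{i=1}^k \frac{1}{2|x-p_i|}$ on $U$. Let $\pi:X_0\to U$ be the principal $S^1$-bundle (with $S^1=\mathbb{R}/2\pi\mathbb{Z}$) carrying a connection $1$-form $\eta$ (that is, $\eta$ is $S^1$-invariant and $\eta(\xi)=1$, with $\xi$ the infinitesimal generator of the action) such that $d\eta=\pi^*( *_{\mathbb{R}^3}d\phi)$, and put $g=\phi^{-1}\eta^2+\phi\,\pi^*g_{\mathbb{R}^3}$. Adding one point over each $p_i$ yields a smooth complete hyperkähler $4$-manifold $(X,g)$ to which the $S^1$-action extends (fixing the added points), and $\pi$ extends to $\pi:X\to\mathbb{R}^3$. It is called a multi-Eguchi--Hanson space if $m=0$ and a multi-Taub--NUT space if $m>0$; the $p_i$ are called the singular points of $\phi$. A hypersurface is a $3$-dimensional submanifold without boundary; minimal means vanishing mean curvature vector. *)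

(* Defs.v *)
From HB Require Import structures.
From mathcomp Require Import all_boot all_order all_algebra.
From mathcomp Require Import all_classical all_reals all_analysis.

Set Implicit Arguments.
Unset Strict Implicit.
Unset Printing Implicit Defensive.

Import Order.TTheory GRing.Theory Num.Theory.
Import numFieldNormedType.Exports.

Local Open Scope classical_set_scope.
Local Open Scope ring_scope.

(* Only meant for open A; f is a total function, its values outside A are
   irrelevant. *)
Fixpoint Ck_on (R : realType) (V W : normedModType R) (k : nat) (A : set V)
    (f : V -> W) : Prop :=
  (forall x, A x -> {for x, continuous f}) /\
  (if k is j.+1 then
     (forall x, A x -> differentiable f x) /\ (forall v, Ck_on j A ('D_v f))
   else True).

Definition smooth_on (R : realType) (V W : normedModType R) (A : set V)
    (f : V -> W) : Prop :=
  forall k, Ck_on k A f.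

(* Vectors are rows, covectors are columns: v *m a is the pairing, and the
   differential of f at y is v |-> v *m 'J f y. *)
Definition pd (R : realType) (n : nat) (W : normedModType R) (i : 'I_n)
    (f : 'rV[R]_n -> W) : 'rV[R]_n -> W :=
  'D_(delta_mx 0 i) f.

Record chart (R : realType) (X : topologicalType) (n : nat) := Chart {
  cdom : set X;
  cmap : X -> 'rV[R]_n;
  cinv : 'rV[R]_n -> X;
  cdom_open : open cdom;
  cimg_open : open (cmap @` cdom);
  cmapK : forall x, cdom x -> cinv (cmap x) = x;
  cmap_continuous : forall x, cdom x -> {for x, continuous cmap};
  cinv_continuous : forall y, (cmap @` cdom) y -> {for y, continuous cinv}
}.

Record manifold (R : realType) (n : nat) := Manifold {
  carrier :> topologicalType;
  atlas : set (chart R carrier n);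
  carrier_hausdorff : hausdorff_space carrier;
  carrier_second_countable : @second_countable carrier;
  atlas_cover : forall x, exists2 c, atlas c & cdom c x;
  atlas_smooth : forall c c', atlas c -> atlas c' ->
    smooth_on (cmap c @` (cdom c `&` cdom c')) (cmap c' \o cinv c)
}.
Arguments atlas {R n} _ _.

Section SmoothMaps.
Context {R : realType}.

(* A is assumed open in the following two definitions. *)
Definition smooth_from (n : nat) (X : manifold R n) (W : normedModType R)
    (A : set X) (f : X -> W) : Prop :=
  forall c, atlas X c ->
    smooth_on (cmap c @` (cdom c `&` A)) (f \o cinv c).

Definition smooth_into (n : nat) (V : normedModType R) (X : manifold R n)
    (A : set V) (f : V -> X) : Prop :=
  (forall y, A y -> {for y, continuous f}) /\
  forall c, atlas X c ->
    smooth_on (A `&` f @^-1` cdom c) (cmap c \o f).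

Definition smooth_map (m n : nat) (N : manifold R m) (X : manifold R n)
    (f : N -> X) : Prop :=
  forall a, atlas N a -> smooth_into (cmap a @` cdom a) (f \o cinv a).

Definition in_charts (m n : nat) (N : manifold R m) (X : manifold R n)
    (a : chart R N m) (c : chart R X n) (f : N -> X) :
    'rV[R]_m -> 'rV[R]_n :=
  cmap c \o f \o cinv a.

(* Matrix of the differential of f at q, in the charts a at q and c at f q. *)
Definition diff_mx (m n : nat) (N : manifold R m) (X : manifold R n)
    (a : chart R N m) (c : chart R X n) (f : N -> X) (q : N) : 'M[R]_(m, n) :=
  'J (in_charts a c f) (cmap a q).

Definition immersion (m n : nat) (N : manifold R m) (X : manifold R n)
    (f : N -> X) : Prop :=
  smooth_map f /\
  forall a c q, atlas N a -> atlas X c -> cdom a q -> cdom c (f q) ->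
    row_free (diff_mx a c f q).

End SmoothMaps.

Record riemannian_metric (R : realType) (n : nat) (X : manifold R n) :=
    RiemannianMetric {
  metric_mx :> chart R X n -> X -> 'M[R]_n;
  metric_smooth : forall c, atlas X c ->
    smooth_on (cmap c @` cdom c) (metric_mx c \o cinv c);
  metric_change : forall c c' x, atlas X c -> atlas X c' ->
    cdom c x -> cdom c' x ->
    metric_mx c x =
      diff_mx c c' id x *m metric_mx c' x *m (diff_mx c c' id x)^T;
  metric_sym : forall c x, atlas X c -> cdom c x ->
    (metric_mx c x)^T = metric_mx c x;
  metric_pos : forall c x (v : 'rV[R]_n), atlas X c -> cdom c x -> v != 0 ->
    0 < (v *m metric_mx c x *m v^T) 0 0
}.

Section Forms.
Context {R : realType} {n : nat} {X : manifold R n}.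

Definition is_one_form (A : set X) (eta : chart R X n -> X -> 'cV[R]_n) : Prop :=
  (forall c, atlas X c ->
     smooth_on (cmap c @` (cdom c `&` A)) (eta c \o cinv c)) /\
  (forall c c' x, atlas X c -> atlas X c' -> A x -> cdom c x -> cdom c' x ->
     eta c x = diff_mx c c' id x *m eta c' x).

(* (d eta)_ij = d_i eta_j - d_j eta_i *)
Definition ext_deriv (eta : chart R X n -> X -> 'cV[R]_n) (c : chart R X n)
    (x : X) (i j : 'I_n) : R :=
  pd i (eta c \o cinv c) (cmap c x) j 0 - pd j (eta c \o cinv c) (cmap c x) i 0.

End Forms.

Section MeanCurvature.
Context {R : realType} {n : nat} {X : manifold R n} (g : riemannian_metric X).

Definition metric_pd (c : chart R X n) (x : X) (i : 'I_n) : 'M[R]_n :=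
  pd i (g c \o cinv c) (cmap c x).

(* Gamma^l_ij = 1/2 g^lk (d_i g_jk + d_j g_ik - d_k g_ij) *)
Definition christoffel (c : chart R X n) (x : X) (i j : 'I_n) : 'rV[R]_n :=
  \row_l (2^-1 * \sum_k invmx (g c x) l k *
    (metric_pd c x i j k + metric_pd c x j i k - metric_pd c x k i j)).

Context {d : nat} {N : manifold R d} (f : N -> X).
Variables (a : chart R N d) (c : chart R X n) (q : N).

Definition induced_metric : 'M[R]_d :=
  diff_mx a c f q *m g c (f q) *m (diff_mx a c f q)^T.

(* v minus its g-orthogonal projection onto the image of the differential *)
Definition normal_part (v : 'rV[R]_n) : 'rV[R]_n :=
  v - v *m g c (f q) *m (diff_mx a c f q)^T *m invmx induced_metric
        *m diff_mx a c f q.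

(* The ambient Levi-Civita derivative of d_j f in the direction d_i f *)
Definition ambient_cov_deriv (i j : 'I_d) : 'rV[R]_n :=
  pd i (pd j (in_charts a c f)) (cmap a q) +
  \sum_k \sum_l (diff_mx a c f q i k * diff_mx a c f q j l)
                  *: christoffel c (f q) k l.

Definition second_fundamental_form (i j : 'I_d) : 'rV[R]_n :=
  normal_part (ambient_cov_deriv i j).

Definition mean_curvature : 'rV[R]_n :=
  \sum_i \sum_j invmx induced_metric i j *: second_fundamental_form i j.

End MeanCurvature.

Definition minimal (R : realType) (n d : nat) (X : manifold R n)
    (g : riemannian_metric X) (N : manifold R d) (f : N -> X) : Prop :=
  forall a c q, atlas N a -> atlas X c -> cdom a q -> cdom c (f q) ->
    mean_curvature g f a c q = 0.

(* Submanifolds are immersed, f : N -> X; embedded ones are the case where f is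
   an inclusion. *)
Definition compact_minimal_hypersurface (R : realType) (X : manifold R 4)
    (g : riemannian_metric X) (N : manifold R 3) (f : N -> X) : Prop :=
  [/\ [set: N] !=set0, compact [set: N], immersion f & minimal g f].

Section GibbonsHawking.
Context {R : realType}.

(* The norm of 'rV[R]_3 in the library is the sup norm. *)
Definition enorm (n : nat) (v : 'rV[R]_n) : R :=
  Num.sqrt (\sum_i v 0 i ^+ 2).

Definition gh_potential (m : R) (k : nat) (p : 'I_k -> 'rV[R]_3)
    (x : 'rV[R]_3) : R :=
  m + \sum_i (2 * enorm (x - p i))^-1.

Definition punctured_space (k : nat) (p : 'I_k -> 'rV[R]_3) : set 'rV[R]_3 :=
  [set x | forall i, x <> p i].

Definition differential (n : nat) (f : 'rV[R]_n -> R) (x : 'rV[R]_n) : 'cV[R]_n :=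
  \col_i pd i f x.

(* Hodge star of a covector in oriented Euclidean R^3:
   ( *al)(v, w) = vol(al^#, v, w) *)
Definition hodge_star (al : 'cV[R]_3) (v w : 'rV[R]_3) : R :=
  \det (col_mx al^T (col_mx v w) : 'M[R]_3).

(* Actions of S^1 = R / 2 pi Z, as 2 pi-periodic actions of R *)
Definition smooth_circle_action (n : nat) (X : manifold R n)
    (act : R -> X -> X) : Prop :=
  [/\ forall x, act 0 x = x,
      forall s t x, act (s + t) x = act s (act t x),
      forall x, act (2 * pi) x = x
    & forall c, atlas X c ->
        smooth_into [set z : R * 'rV[R]_n | (cmap c @` cdom c) z.2]
          (fun z => act z.1 (cinv c z.2))].

(* Components in c of the infinitesimal generator of the action *)
Definition generator (n : nat) (X : manifold R n) (act : R -> X -> X)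
    (c : chart R X n) (x : X) : 'rV[R]_n :=
  'D_1 (fun t : R => cmap c (act t x)) 0.

(* tau induces an equivariant diffeomorphism V * S^1 -> proj @^-1` V; its
   inverse is (proj, u), where u takes its values in the unit circle. *)
Definition local_trivialization (n d : nat) (X : manifold R n)
    (proj : X -> 'rV[R]_d) (act : R -> X -> X) (V : set 'rV[R]_d)
    (tau : 'rV[R]_d -> R -> X) (u : X -> R * R) : Prop :=
  [/\ smooth_into [set z : 'rV[R]_d * R | V z.1] (fun z => tau z.1 z.2),
      smooth_from (proj @^-1` V) u,
      forall v t, V v -> proj (tau v t) = v /\ u (tau v t) = (cos t, sin t),
      forall x, V (proj x) -> exists t, tau (proj x) t = x
    & forall v s t, V v -> tau v (s + t) = act s (tau v t)].

Definition principal_circle_bundle (n d : nat) (X : manifold R n)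
    (proj : X -> 'rV[R]_d) (act : R -> X -> X) (U : set 'rV[R]_d) : Prop :=
  smooth_from (proj @^-1` U) proj /\
  forall y, U y -> exists V tau u,
    [/\ open V, V y, V `<=` U & local_trivialization proj act V tau u].

Definition connection_form (n : nat) (X : manifold R n) (act : R -> X -> X)
    (A : set X) (eta : chart R X n -> X -> 'cV[R]_n) : Prop :=
  [/\ is_one_form A eta,
      forall t c c' x, atlas X c -> atlas X c' -> A x ->
        cdom c x -> cdom c' (act t x) ->
        eta c x = diff_mx c c' (act t) x *m eta c' (act t x)
    & forall c x, atlas X c -> A x -> cdom c x ->
        generator act c x *m eta c x = 1%:M].

(* Differential of proj at x in the chart c: row i is d_i proj. *)
Definition proj_mx (n d : nat) (X : manifold R n) (proj : X -> 'rV[R]_d)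
    (c : chart R X n) (x : X) : 'M[R]_(n, d) :=
  'J (proj \o cinv c) (cmap c x).

(* X_0 is proj @^-1` (punctured_space p) and X has one more point over each p i.
   Smoothness of g at the added points is part of riemannian_metric; that g is
   complete and hyperkaehler follows and is not required. *)
Record gibbons_hawking_data (m : R) (k : nat) (p : 'I_k -> 'rV[R]_3)
    (X : manifold R 4) (g : riemannian_metric X) (proj : X -> 'rV[R]_3)
    (act : R -> X -> X) (eta : chart R X 4 -> X -> 'cV[R]_4) : Prop := {
  gh_nonempty : (0 < k)%N;
  gh_distinct : injective p;
  gh_mass : 0 <= m;
  gh_proj : continuous proj;
  gh_act : smooth_circle_action act;
  gh_added_point : forall i, exists! x, proj x = p i;
  gh_fixed : forall i t x, proj x = p i -> act t x = x;
  gh_bundle : principal_circle_bundle proj act (punctured_space p);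
  gh_connection : connection_form act (proj @^-1` punctured_space p) eta;
  gh_curvature : forall c x i j, atlas X c -> cdom c x ->
    punctured_space p (proj x) ->
    ext_deriv eta c x i j =
      hodge_star (differential (gh_potential m p) (proj x))
        (row i (proj_mx proj c x)) (row j (proj_mx proj c x));
  gh_metric : forall c x, atlas X c -> cdom c x ->
    punctured_space p (proj x) ->
    g c x =
      (gh_potential m p (proj x))^-1 *: (eta c x *m (eta c x)^T) +
      gh_potential m p (proj x) *: (proj_mx proj c x *m (proj_mx proj c x)^T)
}.

Definition gibbons_hawking_space (m : R) (k : nat) (p : 'I_k -> 'rV[R]_3)
    (X : manifold R 4) (g : riemannian_metric X) : Prop :=
  exists proj act eta, gibbons_hawking_data m p g proj act eta.

Definition multi_eguchi_hanson (k : nat) (p : 'I_k -> 'rV[R]_3)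
    (X : manifold R 4) (g : riemannian_metric X) : Prop :=
  gibbons_hawking_space 0 p g.

Definition multi_taub_nut (k : nat) (p : 'I_k -> 'rV[R]_3)
    (X : manifold R 4) (g : riemannian_metric X) : Prop :=
  exists2 m, 0 < m & gibbons_hawking_space m p g.

Definition collinear (k n : nat) (p : 'I_k -> 'rV[R]_n) : Prop :=
  exists a v : 'rV[R]_n, v != 0 /\ forall i, exists t : R, p i = a + t *: v.

End GibbonsHawking.

(* Main.v *)
Require Import Defs.
From mathcomp Require Import all_boot all_order all_algebra.
From mathcomp Require Import all_classical all_reals all_analysis.
From mathcomp Require Import ring lra.

Set Implicit Arguments.
Unset Strict Implicit.
Unset Printing Implicit Defensive.

Import Order.TTheory GRing.Theory Num.Theory.
Import numFieldNormedType.Exports.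

Local Open Scope classical_set_scope.
Local Open Scope ring_scope.

(* Let h be the squared distance to the line through the singular points,
   pulled back to X. At a maximum q of h on the hypersurface off that line, the
   tangent space is the orthogonal complement of grad h, spanned by the circle
   direction and the horizontal lifts of the axis direction e and of a unit
   vector theta orthogonal to e and to the radial direction. The trace of
   Hess h / 2 over it is (1 + <grad phi, grad h> / (4 phi)) / phi, with the
   Euclidean product <grad phi, grad h> at least - 2 phi because the distance
   to the line is at most the distance to each singular point. It is thus
   positive, but for a minimal hypersurface it is the Laplacian of the
   restriction of h / 2, which is nonpositive at a maximum. So h vanishes on
   the hypersurface, whereas the preimage of the line has dimension 2. *)

(** * Second-order calculus *)

(** Minimality is paired with a single covector, the differential of h / 2 at q, so only the
    Christoffel symbols contracted with it have to be computed. The obstacle is that this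
    contraction contains second derivatives of the projection along the frame, about which nothing
    is known. The same terms appear in the chain rule for the second derivative of the restriction
    of h, and there they cancel. What survives are first derivatives of phi and a term eta(E) d
    eta(E, W), with E a frame vector and W the gradient of h / 2. This dictates the frame: each E is
    either horizontal, so that eta(E) = 0, or vertical, and then d eta, being pulled back from R^3,
    vanishes on it. The vertical vector contributes the derivative of phi with the sign opposite to
    the two horizontal ones, so one half of it remains and the lower bound on it leaves a margin.
    Lying over the line contradicts the immersion only where the projection is a submersion, so a
    point away from the fixed points is needed; one exists because the fibre over each singular
    point is a single point. *)

Section DirectionalDerivatives.
Context {R : realType}.

Lemma is_derive_line (V W : normedModType R) (f : V -> W) (x v : V) (t : R) :
  derivable f (t *: v + x) v ->
  is_derive t 1 (fun s : R => f (s *: v + x)) ('D_v f (t *: v + x)).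
Proof.
move=> df.
have E : (fun h : R => h^-1 *: (((fun s : R => f (s *: v + x)) \o shift t) (h *: 1)
    - f (t *: v + x))) =
  (fun h : R => h^-1 *: ((f \o shift (t *: v + x)) (h *: v) - f (t *: v + x))).
  by apply/funext => h /=; rewrite [h *: 1]mulr1 scalerDl addrA.
by split; rewrite /derivable /derive /= E.
Qed.

Lemma is_derive_at_line (V W : normedModType R) (f : V -> W) (x v : V) (l : W) :
  is_derive (0 : R) 1 (fun s : R => f (s *: v + x)) l -> is_derive x v f l.
Proof.
case=> df <-; have dfx : derivable f x v by apply/derivable1P.
split=> //.
have {1}-> : x = 0 *: v + x by rewrite scale0r add0r.
apply/esym/(@derive_val _ _ _ _ _ _ _ (is_derive_line _)).
by rewrite scale0r add0r.
Qed.

Lemma is_deriveMl (V : normedModType R) (f g : V -> R) x v df dg :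
  is_derive x v f df -> is_derive x v g dg ->
  is_derive x v (fun y => f y * g y) (df * g x + f x * dg).
Proof.
move=> Df Dg; have -> : df * g x + f x * dg = f x *: dg + g x *: df.
  by rewrite addrC mulrC [df * _]mulrC [dg * _]mulrC.
exact: is_deriveM.
Qed.

Lemma is_derive_sumf (V W : normedModType R) n (h : 'I_n -> V -> W) x v dh :
  (forall i, is_derive x v (h i) (dh i)) ->
  is_derive x v (fun y => \sum_i h i y) (\sum_i dh i).
Proof.
move=> Dh; rewrite (_ : (fun y => _) = \sum_i h i); first exact: is_derive_sum.
by apply/funext => y; rewrite fct_sumE.
Qed.

Lemma is_derive_mx (V : normedModType R) m n (M : V -> 'M[R]_(m, n)) x v
    (dM : 'M[R]_(m, n)) :
  (forall i j, is_derive x v (fun y => M y i j) (dM i j)) <-> is_derive x v M dM.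
Proof.
split=> [H|[dv <-] i j].
  have dv : derivable M x v by apply/derivable_mxP => i j; have [] := H i j.
  split=> //; rewrite derive_mx //; apply/matrixP => i j.
  by rewrite !mxE; have [_ <-] := H i j.
split; first by move/derivable_mxP : dv; apply.
by rewrite derive_mx // mxE.
Qed.

Lemma is_derive_near (V W : normedModType R) (A : set V) (f g : V -> W) x v l :
  open A -> A x -> (forall y, A y -> f y = g y) ->
  is_derive x v f l -> is_derive x v g l.
Proof.
move=> oA Ax fg; apply: near_eq_is_derive.
by apply: filterS (open_nbhs_nbhs (conj oA Ax)) => y /fg.
Qed.

Lemma derive_near (V W : normedModType R) (A : set V) (f g : V -> W) x v :
  open A -> A x -> (forall y, A y -> f y = g y) -> 'D_v f x = 'D_v g x.
Proof.
move=> oA Ax fg; apply: near_eq_derive.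
by apply: filterS (open_nbhs_nbhs (conj oA Ax)) => y /fg.
Qed.

Lemma derive_row (W : normedModType R) n (f : 'rV[R]_n -> W) x v :
  differentiable f x -> 'D_v f x = \sum_i v 0 i *: 'D_(delta_mx 0 i) f x.
Proof.
move=> df; rewrite deriveE // {1}(row_sum_delta v) linear_sum.
by apply: eq_bigr => i _; rewrite linearZ deriveE.
Qed.

Lemma derive_compE (U V W : normedModType R) (f : U -> V) (h : V -> W) x v :
  differentiable f x -> differentiable h (f x) ->
  is_derive x v (h \o f) ('D_('D_v f x) h (f x)).
Proof.
move=> df dh; have dhf : differentiable (h \o f) x by exact: differentiable_comp.
split; first exact: diff_derivable.
by rewrite (deriveE _ dhf) (deriveE _ dh) (deriveE _ df) diff_comp.
Qed.

(** Since [f] is only known to be derivable along [v], the chain rule is applied to its restriction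
    to the line through [x]. *)
Lemma is_derive_comp1 (V : normedModType R) (f : V -> R) (h : R -> R) x v df dh :
  is_derive x v f df -> is_derive (f x) 1 h dh ->
  is_derive x v (fun y => h (f y)) (dh * df).
Proof.
move=> [Df <-] [Dh <-]; apply: is_derive_at_line.
have Dl : derivable f (0 *: v + x) v by rewrite scale0r add0r.
have [D0 E0] := is_derive_line Dl.
have fE : f (0 *: v + x) = f x by rewrite scale0r add0r.
have D1 : differentiable (fun s : R => f (s *: v + x)) (0 : R) by apply/derivable1_diffP.
have Dh' : derivable h (f (0 *: v + x)) 1.
  exact: (eq_ind_r (fun z => derivable h z 1) Dh fE).
have D2 : differentiable h (f (0 *: v + x)) by apply/derivable1_diffP; exact: Dh'.
split; first by apply/derivable1_diffP/(differentiable_comp D1 D2).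
rewrite -derive1E (derive1_comp D0 Dh') !derive1E fE E0.
by rewrite scale0r add0r.
Qed.

Lemma is_derive_inv (V : normedModType R) (f : V -> R) x v df :
  f x != 0 -> is_derive x v f df ->
  is_derive x v (fun y => (f y)^-1) (- (f x) ^- 2 * df).
Proof. by move=> f0 [Df <-]; split; [exact: derivableV|rewrite deriveV]. Qed.

Lemma is_deriveMc (V : normedModType R) (f : V -> R) (c : R) x v df :
  is_derive x v f df -> is_derive x v (fun y => c * f y) (c * df).
Proof.
by move=> Df; have := is_deriveMl (is_derive_cst c x v) Df; rewrite mul0r add0r.
Qed.

End DirectionalDerivatives.

Section TwiceDifferentiable.
Context {R : realType}.

Section Ck.
Variables (V W : normedModType R) (A : set V) (f : V -> W).
Hypothesis C2 : Ck_on 2 A f.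

Lemma C2_diff x : A x -> differentiable f x.
Proof. by case: C2 => _ [+ _]; apply. Qed.

Lemma C2_diff2 v x : A x -> differentiable ('D_v f) x.
Proof. by case: C2 => _ [_ /(_ v)] [_ [+ _]]; apply. Qed.

Lemma C2_cont v w x : A x -> {for x, continuous ('D_w ('D_v f))}.
Proof. by case: C2 => _ [_ /(_ v)] [_ [_ /(_ w)]] [+ _]; apply. Qed.

Lemma C2_is_derive v x : A x -> is_derive x v f ('D_v f x).
Proof. by move=> Ax; apply/derivableP/diff_derivable/C2_diff. Qed.

Lemma C2_is_derive2 v w x : A x -> is_derive x w ('D_v f) ('D_w ('D_v f) x).
Proof. by move=> Ax; apply/derivableP/diff_derivable/C2_diff2. Qed.

End Ck.

Lemma differentiable_near0 (V W : normedModType R) (f : V -> W) x :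
  (\near x, f x = 0) -> differentiable f x.
Proof.
move=> f0.
have E : f \o shift x = cst (f x) + (\0 : {linear V -> W}) +o_ 0 id.
  apply/eqaddoP => e e0.
  have f0' := f0; rewrite (near_shift 0 x) subr0 in f0'.
  apply: filterS f0' => h /= fh.
  rewrite !fctE /= fh.
  by rewrite (nbhs_singleton f0) addr0 subr0 normr0 mulr_ge0 // ltW.
have c0 : continuous (\0 : {linear V -> W}) by move=> y; exact: cvg_cst.
by apply/diff_locallyP; rewrite (diff_unique c0 E).
Qed.

Lemma near_eq_differentiable (V W : normedModType R) (f g : V -> W) x :
  (\near x, f x = g x) -> differentiable f x -> differentiable g x.
Proof.
move=> fg df; have -> : g = f + (g - f) by rewrite addrC subrK.
apply: (differentiableD df); apply: differentiable_near0.
by apply: filterS fg => y fgy; rewrite !fctE fgy subrr.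
Qed.

(** On an open set, directional derivatives depend only on the values there, so the recursion in
    [Ck_on] transfers step by step. *)
Lemma Ck_on_ext (V W : normedModType R) k (A : set V) (f g : V -> W) :
  open A -> (forall x, A x -> f x = g x) -> Ck_on k A f -> Ck_on k A g.
Proof.
move=> oA.
have near_fg (h1 h2 : V -> W) x : (forall x, A x -> h1 x = h2 x) -> A x ->
    \near x, h1 x = h2 x.
  by move=> hE Ax; apply: filterS (open_nbhs_nbhs (conj oA Ax)) => y /hE.
elim: k f g => [|k IH] f g fg [cf rest]; split.
- move=> x Ax; rewrite /prop_for /continuous_at -(fg _ Ax).
  by apply: cvg_trans (cf _ Ax); apply: near_eq_cvg; exact: near_fg.
- by [].
- move=> x Ax; rewrite /prop_for /continuous_at -(fg _ Ax).
  by apply: cvg_trans (cf _ Ax); apply: near_eq_cvg; exact: near_fg.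
case: rest => df Df; split=> [x Ax|v].
  by apply: near_eq_differentiable (df _ Ax); exact: near_fg.
by apply: (IH ('D_v f)) (Df v) => x Ax; exact: derive_near fg.
Qed.

Lemma Ck_on_coord (V : normedModType R) k (A : set V) m n (f : V -> 'M[R]_(m, n)) i j :
  open A -> Ck_on k A f -> Ck_on k A (fun x => f x i j).
Proof.
move=> oA; elim: k f => [|k IH] f [cf rest]; split.
- by move=> x Ax; apply: (@continuous_comp _ _ _ f (fun M : 'M[R]_(m, n) => M i j));
    [exact: cf|exact: coord_continuous].
- by [].
- by move=> x Ax; apply: (@continuous_comp _ _ _ f (fun M : 'M[R]_(m, n) => M i j));
    [exact: cf|exact: coord_continuous].
case: rest => df Df; split=> [x Ax|v].
  by apply: (@differentiable_comp _ _ _ _ f (fun M : 'M[R]_(m, n) => M i j));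
    [exact: df|exact: differentiable_coord].
apply: (Ck_on_ext oA _ (IH _ (Df v))) => x Ax.
by rewrite derive_mx ?mxE //; exact/diff_derivable/df.
Qed.

(** Two uses of the mean value theorem: along [v] for the increment of [f] by [s *: w], then along
    [w] for ['D_v f]. *)
Lemma second_difference (V : normedModType R) (A : set V) (f : V -> R) x v w s :
  0 < s -> Ck_on 2 A f ->
  (forall a b, 0 <= a <= s -> 0 <= b <= s -> A (a *: v + (b *: w + x))) ->
  exists a b, [/\ 0 <= a <= s, 0 <= b <= s &
    f (s *: v + (s *: w + x)) - f (s *: v + x) - (f (s *: w + x) - f x) =
    s ^+ 2 * 'D_w ('D_v f) (a *: v + (b *: w + x))].
Proof.
move=> s0 C2 sA.
have sA0 a : 0 <= a <= s -> A (a *: v + x).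
  by move=> as_; have := sA a 0 as_; rewrite scale0r add0r lexx (ltW s0); apply.
pose G t := f (t *: v + (s *: w + x)) - f (t *: v + x).
have dG t : 0 <= t <= s -> is_derive t 1 G
    ('D_v f (t *: v + (s *: w + x)) - 'D_v f (t *: v + x)).
  move=> ts; apply: is_deriveB; apply: is_derive_line; apply: diff_derivable;
  apply: (C2_diff C2); first by apply: sA; rewrite // lexx ltW.
  exact: sA0.
have [a as_ Ga] : exists2 a, a \in `]0, s[%R & G s - G 0 =
    ('D_v f (a *: v + (s *: w + x)) - 'D_v f (a *: v + x)) * (s - 0).
  apply: (MVT s0) => [t|].
    by rewrite in_itv /= => /andP[t0 ts]; apply: dG; rewrite !ltW.
  apply: continuous_in_subspaceT => t; rewrite inE /= in_itv /= => ts.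
  apply/differentiable_continuous/derivable1_diffP.
  by have [] := dG t ts.
have {}as_ : 0 <= a <= s by move: as_; rewrite in_itv /= => /andP[? ?]; rewrite !ltW.
pose K t := 'D_v f (t *: w + (a *: v + x)).
have A' b : 0 <= b <= s -> A (b *: w + (a *: v + x)).
  by move=> bs; rewrite addrCA; exact: sA.
have dK t : 0 <= t <= s -> is_derive t 1 K ('D_w ('D_v f) (t *: w + (a *: v + x))).
  move=> ts; apply: is_derive_line; apply: diff_derivable.
  by apply: (C2_diff2 C2); exact: A'.
have [b bs Kb] : exists2 b, b \in `]0, s[%R & K s - K 0 =
    'D_w ('D_v f) (b *: w + (a *: v + x)) * (s - 0).
  apply: (MVT s0 (df := fun t => 'D_w ('D_v f) (t *: w + (a *: v + x)))) => [t|].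
    by rewrite in_itv /= => /andP[t0 ts]; apply: dK; rewrite !ltW.
  apply: continuous_in_subspaceT => t; rewrite inE /= in_itv /= => ts.
  apply/differentiable_continuous/derivable1_diffP.
  by have [] := dK t ts.
exists a, b; split=> //; first by move: bs; rewrite in_itv /= => /andP[? ?]; rewrite !ltW.
move: Ga; rewrite /G scale0r !add0r => ->.
move: Kb; rewrite /K scale0r add0r [s *: w + (_ + _)]addrCA => ->.
by rewrite subr0 [b *: w + (_ + _)]addrCA expr2 mulrC mulrA mulrAC.
Qed.

(** The second difference is symmetric in [v] and [w], so the two mixed derivatives take a common
    value at points arbitrarily close to [x]; continuity then gives equality at [x]. *)
Lemma schwarz (V : normedModType R) (A : set V) (f : V -> R) x v w :
  open A -> A x -> Ck_on 2 A f -> 'D_w ('D_v f) x = 'D_v ('D_w f) x.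
Proof.
move=> oA Ax C2; apply/eqP; rewrite -subr_eq0 -normr_le0; apply/ler_addgt0Pr => e e0.
rewrite add0r.
have e20 : 0 < e / 2 by lra.
have /cvgrPdist_lt /(_ _ e20) c1 := C2_cont (v := v) (w := w) C2 Ax.
have /cvgrPdist_lt /(_ _ e20) c2 := C2_cont (v := w) (w := v) C2 Ax.
have /nbhs_ballP[r /= r0 Br] : nbhs x [set y |
    [/\ `|'D_w ('D_v f) x - 'D_w ('D_v f) y| < e / 2,
        `|'D_v ('D_w f) x - 'D_v ('D_w f) y| < e / 2 & A y]].
  apply: filterS3 c1 c2 (open_nbhs_nbhs (conj oA Ax)) => y h1 h2 h3.
  exact: And3 h1 h2 h3.
(* The parallelogram with sides [s *: v] and [s *: w] fits in the ball of radius [r]; the [+ 1]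
   covers [v = w = 0]. *)
pose s := r / (`|v| + `|w| + 1) / 2.
have vw0 : 0 < `|v| + `|w| + 1 by rewrite ltr_wpDl ?addr_ge0.
have s0 : 0 < s by rewrite !divr_gt0.
have inB a b : 0 <= a <= s -> 0 <= b <= s -> ball x r (a *: v + (b *: w + x)).
  move=> /andP[a0 as_] /andP[b0 bs]; rewrite -ball_normE /= addrA opprD addrCA subrr addr0.
  rewrite normrN (le_lt_trans (ler_normD _ _)) // !normrZ !ger0_norm //.
  apply: (@le_lt_trans _ _ (s * (`|v| + `|w| + 1))).
    rewrite -addrA mulrDr lerD ?ler_wpM2r // mulrDr mulr1 ler_wpDr ?(ltW s0) //.
    by rewrite ler_wpM2r.
  rewrite /s mulrAC divfK ?gt_eqF //; lra.
have inA a b : 0 <= a <= s -> 0 <= b <= s -> A (a *: v + (b *: w + x)).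
  by move=> ha hb; have [] := Br _ (inB _ _ ha hb).
have [a [b [ha hb E1]]] := second_difference s0 C2 inA.
have inA' b' a' : 0 <= b' <= s -> 0 <= a' <= s -> A (b' *: w + (a' *: v + x)).
  by move=> *; rewrite addrCA; exact: inA.
have [b' [a' [hb' ha' E2]]] := second_difference s0 C2 inA'.
have [B1 _ _] := Br _ (inB _ _ ha hb).
have [_ B2 _] := Br _ (inB _ _ ha' hb').
have E : 'D_w ('D_v f) (a *: v + (b *: w + x)) =
         'D_v ('D_w f) (b' *: w + (a' *: v + x)).
  apply: (@mulfI _ (s ^+ 2)); first by rewrite expf_neq0 ?gt_eqF.
  apply: (etrans (esym E1)); apply: etrans E2; rewrite (addrCA (s *: w)).
  move: (f _) (f (s *: v + x)) (f (s *: w + x)) (f x) => f1 f2 f3 f4.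
  by rewrite !opprB addrACA [RHS]addrACA [- f2 + _]addrC.
rewrite {}E addrCA in B1.
move: B1 B2; move: ('D_w ('D_v f) x) ('D_v ('D_w f) x) ('D_v _ _) => d1 d2 d3 B1 B2.
by rewrite (le_trans (ler_distD d3 _ _)) // [X in _ + X]distrC [leRHS]splitr ltW // ltrD.
Qed.

(* As [u' 0 = 0], a positive [u'' 0] would make [u] increase to the right of [0]. *)
Lemma second_derivative_le0 (u du : R -> R) (r l : R) : 0 < r ->
  (forall t, `|t| < r -> is_derive (t : R) 1 u (du t)) -> is_derive (0 : R) 1 du l ->
  (forall t, `|t| < r -> u t <= u 0) -> du 0 = 0 /\ l <= 0.
Proof.
move=> r0 Du Ddu umax.
have inr t : t \in `](-r), r[%R -> `|t| < r.
  by rewrite in_itv /= ltr_norml.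
have du0 : du 0 = 0.
  have r00 : `|0 : R| < r by rewrite normr0.
  have D0 : is_derive (0 : R) 1 u 0.
    apply: (@derive1_at_max _ u (-r) r).
    - lra.
    - by move=> t /inr /Du[].
    - by rewrite in_itv /= oppr_lt0 r0.
    - by move=> t /inr; exact: umax.
  by have [_ <-] := Du 0 r00; have [_ ->] := D0.
split=> //; rewrite leNgt; apply/negP => l0.
have [dd dl] := Ddu.
(* With tolerance [l] itself, the difference quotients of [du] near [0] are positive. *)
have := dd; rewrite /derivable => /cvgrPdist_lt /(_ _ l0).
rewrite -/(derive du 0 1) dl => /nbhs_ballP[s /= s0 Bs].
pose t := Num.min r s / 2.
have t0 : 0 < t by rewrite divr_gt0 // lt_min r0.
have tr : t < r.
  by have : Num.min r s <= r; [rewrite ge_min lexx|rewrite /t; lra].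
have ts : t < s.
  by have : Num.min r s <= s; [rewrite ge_min lexx orbT|rewrite /t; lra].
have [c ct Ec] : exists2 c, c \in `]0, t[%R & u t - u 0 = du c * (t - 0).
  apply: (MVT t0) => [c|].
    by rewrite in_itv /= => /andP[c0 ct]; apply: Du; rewrite gtr0_norm // (lt_trans ct).
  apply: continuous_in_subspaceT => c; rewrite inE /= in_itv /= => /andP[c0 ct].
  apply/differentiable_continuous/derivable1_diffP.
  by have [] : is_derive c 1 u (du c) by apply: Du; rewrite ger0_norm // (le_lt_trans ct).
move: ct; rewrite in_itv /= => /andP[c0 ct].
have duc : 0 < du c.
  have cs : `|0 - c| < s by rewrite sub0r normrN gtr0_norm // (lt_trans ct).
  have := Bs c cs; rewrite gt_eqF // => /(_ isT) /=.
  rewrite du0 subr0 addr0 [c *: 1]mulr1 ltr_norml => /andP[_]; rewrite gtrBl.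
  by rewrite [_ *: _]mulrC pmulr_lgt0 // invr_gt0.
have : u t <= u 0 by apply: umax; rewrite gtr0_norm.
by apply/negP; rewrite -ltNge -subr_gt0 Ec subr0 mulr_gt0.
Qed.

Lemma second_derivative_test (V : normedModType R) (A : set V) (u du : V -> R) x v l :
  open A -> A x ->
  (forall y, A y -> is_derive y v u (du y)) -> is_derive x v du l ->
  (forall y, A y -> u y <= u x) -> du x = 0 /\ l <= 0.
Proof.
move=> oA Ax Du Ddu umax.
have /nbhs_ballP[r /= r0 Br] := open_nbhs_nbhs (conj oA Ax).
pose s := r / (`|v| + 1).
have v0 : 0 < `|v| + 1 by rewrite ltr_wpDl.
have s0 : 0 < s by rewrite divr_gt0.
have inA t : `|t| < s -> A (t *: v + x).
  move=> ts; apply: Br; rewrite -ball_normE /= opprD addrCA subrr addr0 normrN normrZ.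
  apply: (@le_lt_trans _ _ (`|t| * (`|v| + 1))); first by rewrite ler_wpM2l // lerDl.
  by rewrite -ltr_pdivlMr.
have E : 0 *: v + x = x by rewrite scale0r add0r.
have := @second_derivative_le0 (fun t => u (t *: v + x)) (fun t => du (t *: v + x)) s l s0.
rewrite E; apply.
- move=> t /inA At; have [d <-] := Du _ At; exact: is_derive_line.
- case: Ddu => d <-; rewrite -{2}E; apply: is_derive_line; by rewrite E.
- by move=> t /inA; exact: umax.
Qed.

End TwiceDifferentiable.

Section Composition.
Context {R : realType}.

(* The Hessian of a composition along a line, with [E] the velocity of the
   image curve and ['D_C ('D_C F) y] its acceleration. *)
Lemma derive2_comp m n (A : set 'rV[R]_m) (B : set 'rV[R]_n)
    (F : 'rV[R]_m -> 'rV[R]_n) (H : 'rV[R]_n -> R) y C :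
  open A -> open B -> A y -> Ck_on 2 A F -> Ck_on 2 B H -> A `<=` F @^-1` B ->
  let E := 'D_C F y in
  is_derive y C (fun z => 'D_('D_C F z) H (F z))
    ('D_E ('D_E H) (F y) + 'D_('D_C ('D_C F) y) H (F y)).
Proof.
move=> oA oB Ay CF CH AB E.
have Fy := AB _ Ay.
(* The direction ['D_C F z] moves with [z]; expanding it in the standard basis reduces the claim to
   the product rule. *)
pose H' k z := 'D_(delta_mx 0 k) H z.
have dsum v z : B z -> 'D_v H z = \sum_k v 0 k * H' k z.
  by move=> Bz; rewrite (derive_row _ (C2_diff CH Bz)).
apply: (@is_derive_near _ _ _ A (fun z => \sum_k ('D_C F z) 0 k * H' k (F z))) => //.
  by move=> z /AB Bz; rewrite dsum.
have dH' k : differentiable (H' k) (F y) by exact: (C2_diff2 CH).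
have -> : 'D_E ('D_E H) (F y) = \sum_k E 0 k * 'D_E (H' k) (F y).
  rewrite (derive_near E oB Fy (dsum E)).
  have Dk k : is_derive (F y) E (fun z => E 0 k * H' k z) (E 0 k * 'D_E (H' k) (F y)).
    have := is_deriveMl (is_derive_cst (E 0 k) (F y) E)
      (derivableP (diff_derivable (dH' k))).
    by rewrite mul0r add0r; apply.
  by have [_ ->] := is_derive_sumf Dk.
rewrite [X in _ + X]dsum // addrC -big_split /=.
apply: is_derive_sumf => k; apply: is_deriveMl.
  have /is_derive_mx := C2_is_derive2 CF C C Ay; exact.
exact: (derive_compE C (C2_diff CF Ay) (dH' k)).
Qed.

End Composition.

(** * The Gibbons-Hawking potential *)

Section Potential.
Context {R : realType}.

Definition edot n (u w : 'rV[R]_n) : R := (u *m w^T) 0 0.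

Lemma edotE n (u w : 'rV[R]_n) : edot u w = \sum_i u 0 i * w 0 i.
Proof. by rewrite /edot mxE; apply: eq_bigr => i _; rewrite mxE. Qed.

Lemma edotC n (u w : 'rV[R]_n) : edot u w = edot w u.
Proof. by rewrite !edotE; apply: eq_bigr => i _; rewrite mulrC. Qed.

Lemma edotDl n (u u' w : 'rV[R]_n) : edot (u + u') w = edot u w + edot u' w.
Proof. by rewrite /edot mulmxDl mxE. Qed.

Lemma edotZl n c (u w : 'rV[R]_n) : edot (c *: u) w = c * edot u w.
Proof. by rewrite /edot -scalemxAl mxE. Qed.

Lemma edotNl n (u w : 'rV[R]_n) : edot (- u) w = - edot u w.
Proof. by rewrite /edot mulNmx mxE. Qed.

Lemma edotBl n (u u' w : 'rV[R]_n) : edot (u - u') w = edot u w - edot u' w.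
Proof. by rewrite edotDl edotNl. Qed.

Lemma edotZr n c (u w : 'rV[R]_n) : edot u (c *: w) = c * edot u w.
Proof. by rewrite !(edotC u) edotZl. Qed.

Lemma edotBr n (u w w' : 'rV[R]_n) : edot u (w - w') = edot u w - edot u w'.
Proof. by rewrite !(edotC u) edotBl. Qed.

Lemma edot0r n (u : 'rV[R]_n) : edot u 0 = 0.
Proof. by rewrite /edot trmx0 mulmx0 mxE. Qed.

Lemma edot_ge0 n (u : 'rV[R]_n) : 0 <= edot u u.
Proof. by rewrite edotE sumr_ge0 // => i _; rewrite -expr2 sqr_ge0. Qed.

Lemma edot_eq0 n (u : 'rV[R]_n) : (edot u u == 0) = (u == 0).
Proof.
apply/eqP/eqP => [|->]; last by rewrite /edot mul0mx mxE.
rewrite edotE => /eqP; rewrite psumr_eq0 => [/allP u0|i _]; last by rewrite -expr2 sqr_ge0.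
apply/rowP => i; rewrite mxE; apply/eqP.
by have := u0 i (mem_index_enum _); rewrite mulf_eq0 orbb.
Qed.

Lemma edot_gt0 n (u : 'rV[R]_n) : u != 0 -> 0 < edot u u.
Proof. by move=> u0; rewrite lt_neqAle edot_ge0 eq_sym edot_eq0 u0. Qed.

Lemma enormE n (u : 'rV[R]_n) : enorm u = Num.sqrt (edot u u).
Proof. by rewrite /enorm edotE; congr Num.sqrt; apply: eq_bigr => i _; rewrite expr2. Qed.

Lemma enorm_sqr n (u : 'rV[R]_n) : enorm u ^+ 2 = edot u u.
Proof. by rewrite enormE sqr_sqrtr // edot_ge0. Qed.

Lemma enorm_gt0 n (u : 'rV[R]_n) : u != 0 -> 0 < enorm u.
Proof. by move=> u0; rewrite enormE sqrtr_gt0 edot_gt0. Qed.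

Lemma is_derive_edot (V : normedModType R) n (f g : V -> 'rV[R]_n) x v df dg :
  is_derive x v f df -> is_derive x v g dg ->
  is_derive x v (fun y => edot (f y) (g y)) (edot df (g x) + edot (f x) dg).
Proof.
move=> /is_derive_mx Df /is_derive_mx Dg.
rewrite (_ : (fun y => _) = fun y => \sum_i f y 0 i * g y 0 i); last first.
  by apply/funext => y; rewrite edotE.
rewrite !edotE -big_split /=; apply: is_derive_sumf => i.
exact: is_deriveMl.
Qed.

Variables (m : R) (k : nat) (p : 'I_k -> 'rV[R]_3).
Hypotheses (k0 : (0 < k)%N) (m0 : 0 <= m).

Lemma punctured_neq x i : punctured_space p x -> x - p i != 0.
Proof. by move=> /(_ i) /eqP; rewrite subr_eq0. Qed.

Lemma gh_potential_gt0 x : punctured_space p x -> 0 < gh_potential m p x.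
Proof.
move=> Ux; rewrite /gh_potential ltr_wpDl //.
rewrite (bigD1 (Ordinal k0)) //= ltr_wpDr //.
  by rewrite sumr_ge0 // => i _; rewrite invr_ge0 mulr_ge0 // enormE sqrtr_ge0.
by rewrite invr_gt0 mulr_gt0 // enorm_gt0 // punctured_neq.
Qed.

Lemma is_derive_gh_potential (V : normedModType R) (f : V -> 'rV[R]_3) x v df :
  punctured_space p (f x) -> is_derive x v f df ->
  is_derive x v (fun y => gh_potential m p (f y))
    (- \sum_i edot (f x - p i) df / (2 * enorm (f x - p i) ^+ 3)).
Proof.
move=> Ux Df; rewrite -[X in is_derive _ _ _ X]add0r.
apply: (@is_deriveD _ _ _ (cst m)); rewrite -sumrN; apply: is_derive_sumf => i.
have r0 := enorm_gt0 (punctured_neq i Ux).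
have Dd : is_derive x v (fun y => f y - p i) df.
  by rewrite -[df]subr0; apply: is_deriveB.
have De : is_derive x v (fun y => enorm (f y - p i))
    ((2 * enorm (f x - p i))^-1 * (2 * edot (f x - p i) df)).
  rewrite (_ : (fun y => _) = (fun y => Num.sqrt (edot (f y - p i) (f y - p i))));
    last by apply/funext => y; rewrite enormE.
  apply: is_derive_comp1.
    have := is_derive_edot Dd Dd; rewrite [edot df _]edotC -mulr2n mulr_natl; exact.
  rewrite [enorm _]enormE; apply: is_derive1_sqrt.
  by rewrite edot_gt0 // punctured_neq.
have D2 := is_deriveMc 2 De.
have n0 : 2 * enorm (f x - p i) != 0 by rewrite mulf_neq0 // gt_eqF.
have := is_derive_inv (f := fun y => 2 * enorm (f y - p i)) n0 D2.
suff -> : - (2 * enorm (f x - p i)) ^- 2 * (2 * ((2 * enorm (f x - p i))^-1 *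
   (2 * edot (f x - p i) df))) = - (edot (f x - p i) df / (2 * enorm (f x - p i) ^+ 3)) by [].
by field; rewrite gt_eqF.
Qed.

Variables (a e : 'rV[R]_3) (t : 'I_k -> R).
Hypotheses (e1 : edot e e = 1) (pE : forall i, p i = a + t i *: e).

(** The vector [n] over the potential is the projection to R^3 of the gradient W. As [p i] lies on
    the axis, the inner product of [x - p i] with [n] is the squared distance to the axis, so the
    [i]-th term is at most the [i]-th summand of the potential divided by the potential. *)
Lemma axis_derivative_ge x n : punctured_space p x ->
  n = (x - a) - edot (x - a) e *: e ->
  -1 <= - \sum_i edot (x - p i) ((gh_potential m p x)^-1 *: n) /
             (2 * enorm (x - p i) ^+ 3).
Proof.
move=> Ux nE; have phi0 := gh_potential_gt0 Ux.
set phi := gh_potential m p x in phi0 *.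
rewrite lerN2 (eq_bigr (fun i => phi^-1 * (edot (x - p i) n /
   (2 * enorm (x - p i) ^+ 3)))); last first.
  by move=> i _; rewrite edotZr -!mulrA.
rewrite -mulr_sumr mulrC ler_pdivrMr // mul1r.
apply: (@le_trans _ _ (\sum_i (2 * enorm (x - p i))^-1));
  last by rewrite /phi /gh_potential lerDr.
apply: ler_sum => i _.
have r0 := enorm_gt0 (punctured_neq i Ux).
rewrite ler_pdivrMr ?mulr_gt0 ?exprn_gt0 //.
suff le : edot (x - p i) n <= enorm (x - p i) ^+ 2.
  by rewrite (le_trans le) // le_eqVlt; apply/orP; left; apply/eqP; field; rewrite gt_eqF.
rewrite enorm_sqr pE opprD addrA nE; move: (x - a) => y.
rewrite !(edotBl, edotBr, edotZl, edotZr) e1 [edot e y]edotC.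
move: (edot y y) (edot y e) (t i) => A B C.
(* By Pythagoras the gap is the square of the axial offset [B - C] of [x] from [p i]. *)
suff : 0 <= (B - C) ^+ 2 by nra.
exact: sqr_ge0.
Qed.

End Potential.

(** * Christoffel symbols and mean curvature *)

(* Unification would otherwise unfold ['D_v f] to compare unrelated
   directional derivatives. *)
#[local] Opaque derive.

Section MetricDerivative.
Context {R : realType}.

Lemma derive2_coord (V : normedModType R) (A : set V) m n (f : V -> 'M[R]_(m, n)) x v w i j :
  open A -> A x -> Ck_on 2 A f ->
  ('D_w ('D_v f) x) i j = 'D_w ('D_v (fun y => f y i j)) x.
Proof.
move=> oA Ax C2.
have /is_derive_mx /(_ i j) [_ <-] := C2_is_derive2 C2 v w Ax.
apply: derive_near oA Ax _ => y Ay.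
by have /is_derive_mx /(_ i j) [_ ->] := C2_is_derive C2 v Ay.
Qed.

Lemma schwarz_mx (V : normedModType R) (A : set V) m n (f : V -> 'M[R]_(m, n)) x v w :
  open A -> A x -> Ck_on 2 A f -> 'D_w ('D_v f) x = 'D_v ('D_w f) x.
Proof.
move=> oA Ax C2; apply/matrixP => i j.
apply: etrans (derive2_coord v w i j oA Ax C2) _.
apply: etrans _ (esym (derive2_coord w v i j oA Ax C2)).
exact: (schwarz _ _ oA Ax (Ck_on_coord i j oA C2)).
Qed.

Variables (n d : nat) (B : set 'rV[R]_n) (x : 'rV[R]_n).
Variables (pi : 'rV[R]_n -> 'rV[R]_d) (eta : 'rV[R]_n -> 'cV[R]_n).
Variables (phi : 'rV[R]_n -> R) (dphi : 'rV[R]_n -> R) (gm : 'rV[R]_n -> 'M[R]_n).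
Hypotheses (oB : open B) (Bx : B x) (C2pi : Ck_on 2 B pi).
Hypotheses (Deta : differentiable eta x) (phi0 : phi x != 0).
Hypothesis Dphi : forall v, is_derive x v phi (dphi v).
Hypothesis gmE : forall y, B y -> gm y =
  (phi y)^-1 *: (eta y *m (eta y)^T) + phi y *: ('J pi y *m ('J pi y)^T).

Let pair (u : 'rV[R]_n) (c : 'cV[R]_n) : R := (u *m c) 0 0.

Lemma gm_apply u w y : B y -> (u *m gm y *m w^T) 0 0 =
  (phi y)^-1 * (pair u (eta y) * pair w (eta y)) +
  phi y * edot ('D_u pi y) ('D_w pi y).
Proof.
move=> By; have Dp := C2_diff C2pi By.
rewrite gmE // mulmxDr mulmxDl mxE -!scalemxAr -!scalemxAl.
rewrite [X in X + _]mxE [X in _ + X]mxE; congr (_ * _ + _ * _).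
  rewrite mulmxA -(mulmxA (u *m eta y)) -trmx_mul mxE big_ord1.
  by rewrite [X in _ * X]mxE.
by rewrite /edot !deriveEjacobian // trmx_mul !mulmxA.
Qed.

Lemma is_derive_gm z u w :
  is_derive x z (fun y => (u *m gm y *m w^T) 0 0)
    (- (phi x) ^- 2 * dphi z * (pair u (eta x) * pair w (eta x)) +
     (phi x)^-1 * (pair u ('D_z eta x) * pair w (eta x) +
                   pair u (eta x) * pair w ('D_z eta x)) +
     (dphi z * edot ('D_u pi x) ('D_w pi x) +
      phi x * (edot ('D_z ('D_u pi) x) ('D_w pi x) +
               edot ('D_u pi x) ('D_z ('D_w pi) x)))).
Proof.
apply: (@is_derive_near _ _ _ B (fun y => (phi y)^-1 * (pair u (eta y) * pair w (eta y)) +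
  phi y * edot ('D_u pi y) ('D_w pi y))) => //.
  by move=> y By; rewrite gm_apply.
have Dpair v : is_derive x z (fun y => pair v (eta y)) (pair v ('D_z eta x)).
  rewrite (_ : (fun y => _) = fun y => \sum_j v 0 j * eta y j 0); last first.
    by apply/funext => y; rewrite /pair mxE.
  rewrite /pair mxE; apply: is_derive_sumf => j; apply: is_deriveMc.
  have /is_derive_mx : is_derive x z eta ('D_z eta x).
    exact/derivableP/diff_derivable.
  exact.
apply: is_deriveD; apply: is_deriveMl.
- exact: is_derive_inv.
- exact: is_deriveMl.
by apply: is_derive_edot; exact: (C2_is_derive2 C2pi).
Qed.

Hypothesis Dgm : differentiable gm x.

Lemma derive_gm (z u w : 'rV[R]_n) : (u *m 'D_z gm x *m w^T) 0 0 =
  'D_z (fun y => (u *m gm y *m w^T) 0 0) x.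
Proof.
apply/esym/(@derive_val _ _ _ _ _ _ _ _).
have /is_derive_mx H : is_derive x z gm ('D_z gm x) by exact/derivableP/diff_derivable.
have E (N : 'M[R]_n) : (u *m N *m w^T) 0 0 = \sum_j w 0 j * (\sum_i u 0 i * N i j).
  by rewrite mxE; apply: eq_bigr => j _; rewrite !mxE mulrC.
rewrite (_ : (fun y => _) = fun y => \sum_j w 0 j * (\sum_i u 0 i * gm y i j)); last first.
  by apply/funext => y; rewrite E.
rewrite E; apply: is_derive_sumf => j; apply: is_deriveMc.
by apply: is_derive_sumf => i; exact: is_deriveMc.
Qed.

(* The Levi-Civita symbol contracted with the differential of [pi . nn],
   whose gradient is [W]: the second derivatives of [pi] against [E] cancel by
   symmetry and only those against [nn] remain. *)
Lemma levi_civita_contraction (E W : 'rV[R]_n) (nn : 'rV[R]_d) :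
  pair W (eta x) = 0 -> 'D_W pi x = (phi x)^-1 *: nn -> edot ('D_E pi x) nn = 0 ->
  pair E (eta x) * (pair W ('D_E eta x) - pair E ('D_W eta x)) = 0 ->
  (E *m 'D_E gm x *m W^T) 0 0 - 2^-1 * (E *m 'D_W gm x *m E^T) 0 0 =
  2^-1 * (phi x) ^- 2 * dphi W * pair E (eta x) ^+ 2
  - 2^-1 * dphi W * edot ('D_E pi x) ('D_E pi x)
  + edot ('D_E ('D_E pi) x) nn.
Proof.
move=> W0 Wn En cross.
have H1 : (E *m 'D_E gm x *m W^T) 0 0 = _ :=
  etrans (derive_gm E E W) (@derive_val _ _ _ _ _ _ _ (is_derive_gm E E W)).
have H2 : (E *m 'D_W gm x *m E^T) 0 0 = _ :=
  etrans (derive_gm W E E) (@derive_val _ _ _ _ _ _ _ (is_derive_gm W E E)).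
apply: (etrans (congr2 (fun a b => a - 2^-1 * b) H1 H2)) => {H1 H2}.
move: W0 Wn En cross (schwarz_mx E W oB Bx C2pi) phi0.
generalize (pair W (eta x)), (pair E (eta x)), (pair W ('D_E eta x)), (pair E ('D_E eta x)),
  (pair E ('D_W eta x)), (dphi W), (dphi E), (phi x).
generalize ('D_E ('D_E pi) x), ('D_W ('D_E pi) x), ('D_E ('D_W pi) x), ('D_E pi x), ('D_W pi x).
move=> pEE pWE pEW pE pW w e we ee ew dW dE f -> -> En cross <- f0.
rewrite !edotZr En (edotC _ pE) (edotC pEE nn).
move: cross (edot pE _) (edot pE _) (edot nn _) => {pWE pEE pEW pE pW En} cross A B' C'.
(* The derivatives of [eta] survive only in the combination [e * (we - ew)], which is eta(E) d
   eta(E, W). *)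
have {}cross : e * we = e * ew by apply/eqP; rewrite -subr_eq0 -mulrBr cross.
by rewrite cross; field.
Qed.

End MetricDerivative.

Lemma bilinear_sum (R : realType) m n (u : 'rV[R]_m) (w : 'rV[R]_n) (N : 'M[R]_(m, n)) :
  (u *m N *m w^T) 0 0 = \sum_k \sum_l u 0 k * w 0 l * N k l.
Proof.
rewrite mxE exchange_big; apply: eq_bigr => l _ /=.
by rewrite !mxE mulr_suml; apply: eq_bigr => k _; rewrite mulrAC.
Qed.

Lemma derive2_row (R : realType) (W : normedModType R) d (A : set 'rV[R]_d)
    (F : 'rV[R]_d -> W) y C :
  open A -> A y -> Ck_on 2 A F ->
  'D_C ('D_C F) y = \sum_i \sum_j (C 0 i * C 0 j) *: pd i (pd j F) y.
Proof.
move=> oA Ay CF.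
have D1 z : A z -> 'D_C F z = \sum_j C 0 j *: pd j F z.
  by move=> Az; rewrite (derive_row _ (C2_diff CF Az)).
rewrite (derive_near C oA Ay D1) exchange_big /=.
apply: derive_val; apply: is_derive_sumf => j.
have dj : differentiable (pd j F) y by exact: (C2_diff2 CF).
have -> : \sum_i (C 0 i * C 0 j) *: pd i (pd j F) y = C 0 j *: 'D_C (pd j F) y.
  rewrite (derive_row _ dj) scaler_sumr; apply: eq_bigr => i _.
  by rewrite scalerA mulrC.
exact/is_deriveZ/derivableP/diff_derivable.
Qed.

Section Christoffel.
Context {R : realType} {n : nat} {X : manifold R n} (g : riemannian_metric X).

(** Contracting with [dl], the covector dual to [W], cancels the inverse metric. Against the
    symmetric coefficients of [E] the first two terms of the Christoffel symbol agree after
    exchanging indices, which absorbs the factor one half. *)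
Lemma christoffel_contraction (c : chart R X n) (x : X) (E W : 'rV[R]_n) (dl : 'cV[R]_n) :
  differentiable (g c \o cinv c) (cmap c x) ->
  g c x \in unitmx -> (g c x)^T = g c x -> g c x *m W^T = dl ->
  \sum_k \sum_l (E 0 k * E 0 l) * (christoffel g c x k l *m dl) 0 0 =
  (E *m 'D_E (g c \o cinv c) (cmap c x) *m W^T) 0 0
  - 2^-1 * (E *m 'D_W (g c \o cinv c) (cmap c x) *m E^T) 0 0.
Proof.
move=> Dg gU gS gW.
pose T := metric_pd g c x.
have cE k l : (christoffel g c x k l *m dl) 0 0 =
    2^-1 * \sum_h W 0 h * (T k l h + T l k h - T h k l).
  rewrite mxE (eq_bigr (fun a => \sum_h 2^-1 * (invmx (g c x) a h * dl a 0) *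
      (T k l h + T l k h - T h k l))); last first.
    move=> a _; rewrite mxE mulr_sumr mulr_suml; apply: eq_bigr => h _.
    by rewrite -!mulrA; congr (_ * (_ * _)); rewrite mulrC.
  rewrite exchange_big mulr_sumr; apply: eq_bigr => h _ /=.
  rewrite -mulr_suml -mulr_sumr -mulrA; congr (_ * (_ * _)).
  have -> : W 0 h = (invmx (g c x) *m dl) h 0 by rewrite -gW mulKmx // mxE.
  rewrite mxE; apply: eq_bigr => a _; congr (_ * _).
  have ST : (invmx (g c x))^T = invmx (g c x) by rewrite trmx_inv gS.
  by rewrite -{1}ST mxE.
have DE (u v w : 'rV[R]_n) : (u *m 'D_v (g c \o cinv c) (cmap c x) *m w^T) 0 0 =
    \sum_k v 0 k * \sum_l \sum_h u 0 l * w 0 h * T k l h.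
  rewrite (derive_row _ Dg) mulmx_sumr mulmx_suml summxE; apply: eq_bigr => k _.
  by rewrite -scalemxAr -scalemxAl mxE bilinear_sum.
pose S := \sum_k \sum_l \sum_h E 0 k * E 0 l * W 0 h * T k l h.
have -> : (E *m 'D_E (g c \o cinv c) (cmap c x) *m W^T) 0 0 = S.
  rewrite DE; apply: eq_bigr => k _; rewrite mulr_sumr; apply: eq_bigr => l _.
  by rewrite mulr_sumr; apply: eq_bigr => h _; rewrite !mulrA.
pose S' := \sum_k \sum_l \sum_h E 0 k * E 0 l * W 0 h * T h k l.
have -> : (E *m 'D_W (g c \o cinv c) (cmap c x) *m E^T) 0 0 = S'.
  rewrite DE (eq_bigr (fun h => \sum_k \sum_l E 0 k * E 0 l * W 0 h * T h k l)).
    by rewrite exchange_big; apply: eq_bigr => k _; rewrite exchange_big.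
  move=> h _; rewrite mulr_sumr; apply: eq_bigr => k _; rewrite mulr_sumr.
  by apply: eq_bigr => l _; rewrite mulrA [W _ _ * _]mulrC.
have SE : S = \sum_k \sum_l \sum_h E 0 k * E 0 l * W 0 h * T l k h.
  rewrite /S exchange_big; apply: eq_bigr => k _; apply: eq_bigr => l _.
  by apply: eq_bigr => h _; rewrite [E 0 l * _]mulrC.
have -> : S - 2^-1 * S' = 2^-1 * (S + S - S') by field.
rewrite [X in S + X]SE /S /S' -!big_split -sumrB mulr_sumr; apply: eq_bigr => k _ /=.
rewrite -!big_split -sumrB mulr_sumr; apply: eq_bigr => l _ /=.
rewrite -!big_split -sumrB cE /= mulrCA; congr (_ * _).
rewrite mulr_sumr; apply: eq_bigr => h _ /=; ring.
Qed.

End Christoffel.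

Section MeanCurvature.
Context {R : realType} {n d : nat} {X : manifold R n} (g : riemannian_metric X).
Context {N : manifold R d} (f : N -> X).
Variables (a : chart R N d) (c : chart R X n) (q : N).

Let P := diff_mx a c f q.
Let G := induced_metric g f a c q.

Lemma invmx_orthonormal (C : 'M[R]_d) : C *m G *m C^T = 1%:M -> invmx G = C^T *m C.
Proof.
move=> CGC; have GCC : G *m (C^T *m C) = 1%:M.
  by rewrite mulmxA; apply: mulmx1C; rewrite mulmxA.
have GU : G \in unitmx by have [] := mulmx1_unit GCC.
by rewrite -[RHS](mulKmx GU) GCC mulmx1.
Qed.

(* A covector killing the tangent space does not see the tangential projection. *)
Lemma mean_curvature_critical (C : 'M[R]_d) (dl : 'cV[R]_n) :
  mean_curvature g f a c q = 0 -> P *m dl = 0 -> C *m G *m C^T = 1%:M ->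
  \sum_r \sum_i \sum_j (C r i * C r j) * (ambient_cov_deriv g f a c q i j *m dl) 0 0 = 0.
Proof.
move=> H0 Pdl CGC.
have : (mean_curvature g f a c q *m dl) 0 0 = 0 by rewrite H0 mul0mx mxE.
rewrite /mean_curvature mulmx_suml summxE => HH; rewrite -[RHS]HH.
rewrite exchange_big; apply: eq_bigr => i _ /=.
rewrite exchange_big mulmx_suml summxE; apply: eq_bigr => j _ /=.
rewrite -mulr_suml -scalemxAl [RHS]mxE; congr (_ * _).
  rewrite -/G (invmx_orthonormal CGC) mxE; apply: eq_bigr => r _.
  by rewrite mxE.
by rewrite /second_fundamental_form /normal_part mulmxBl -/P -(mulmxA _ P dl) Pdl mulmx0 subr0.
Qed.

(** The covariant acceleration of the image of a straight line with velocity [v]: its coordinate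
    acceleration plus the Christoffel term in the pushed-forward velocity [v *m P]. *)
Lemma ambient_cov_deriv_line (A : set 'rV[R]_d) (v : 'rV[R]_d) (dl : 'cV[R]_n) :
  open A -> A (cmap a q) -> Ck_on 2 A (in_charts a c f) ->
  \sum_i \sum_j (v 0 i * v 0 j) * (ambient_cov_deriv g f a c q i j *m dl) 0 0 =
  ('D_v ('D_v (in_charts a c f)) (cmap a q) *m dl) 0 0 +
  \sum_k \sum_l ((v *m P) 0 k * (v *m P) 0 l) * (christoffel g c (f q) k l *m dl) 0 0.
Proof.
move=> oA Aq CF; rewrite (derive2_row v oA Aq CF).
rewrite mulmx_suml summxE.
have EE (h : 'I_n -> 'I_n -> R) :
    \sum_k \sum_l ((v *m P) 0 k * (v *m P) 0 l) * h k l =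
    \sum_i \sum_j (v 0 i * v 0 j) * (\sum_k \sum_l (P i k * P j l) * h k l).
  have -> : \sum_k \sum_l ((v *m P) 0 k * (v *m P) 0 l) * h k l =
      (v *m P *m (\matrix_(k, l) h k l) *m (v *m P)^T) 0 0.
    rewrite bilinear_sum; apply: eq_bigr => k _; apply: eq_bigr => l _.
    by rewrite [X in _ = _ * X]mxE.
  rewrite trmx_mul !mulmxA -[v *m P *m _ *m _]mulmxA -[v *m P *m _]mulmxA.
  rewrite bilinear_sum; apply: eq_bigr => i _; apply: eq_bigr => j _; congr (_ * _).
  have -> : (P *m ((\matrix_(k, l) h k l) *m P^T)) i j =
     (row i P *m (\matrix_(k, l) h k l) *m (row j P)^T) 0 0.
    by rewrite mulmxA tr_row -row_mul -row_mul !mxE; apply: eq_bigr => k _; rewrite !mxE.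
  rewrite bilinear_sum; apply: eq_bigr => k _; apply: eq_bigr => l _.
  by rewrite !mxE.
rewrite EE -big_split; apply: eq_bigr => i _ /=.
rewrite mulmx_suml summxE -big_split; apply: eq_bigr => j _ /=.
rewrite -scalemxAl [X in X + _]mxE -mulrDr; congr (_ * _).
rewrite /ambient_cov_deriv mulmxDl mxE; congr (_ + _).
rewrite mulmx_suml summxE; apply: eq_bigr => k _.
rewrite mulmx_suml summxE; apply: eq_bigr => l _.
by rewrite -scalemxAl mxE.
Qed.

End MeanCurvature.

(** * Adapted frames and charts *)

Section LinearAlgebra.
Context {R : realType}.

Lemma pos_unitmx n (A : 'M[R]_n) :
  (forall v : 'rV[R]_n, v != 0 -> 0 < (v *m A *m v^T) 0 0) -> A \in unitmx.
Proof.
move=> Apos; rewrite -row_free_unit -kermx_eq0; apply/eqP/row_matrixP => i.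
rewrite row0; apply/eqP/negPn/negP => /Apos.
by rewrite -row_mul mulmx_ker row0 mul0mx mxE ltxx.
Qed.

(** A row killed by [et] and [J] is killed by the invertible metric, hence zero. So the square
    matrix [row_mx et J] is invertible, and the vertical and horizontal components can be prescribed
    freely. *)
Lemma dual_frame n (phi : R) (et : 'cV[R]_n.+1) (J : 'M[R]_(n.+1, n)) :
  phi^-1 *: (et *m et^T) + phi *: (J *m J^T) \in unitmx ->
  forall (s : R) (b : 'rV[R]_n), exists E : 'rV[R]_n.+1, (E *m et) 0 0 = s /\ E *m J = b.
Proof.
set g := _ + _ => gU s b.
pose M : 'M[R]_(n.+1, 1 + n) := row_mx et J.
have Mfull : row_full M.
  suff : row_free M by [].
  rewrite -kermx_eq0; have : kermx M *m M = 0 by exact: mulmx_ker.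
  rewrite {2}/M mul_mx_row -[RHS]row_mx0 => /eq_row_mx[K1 K2].
  have : kermx M *m g = 0.
    by rewrite /g mulmxDr -!scalemxAr !mulmxA K1 K2 !mul0mx !scaler0 addr0.
  by move=> /(congr1 (mulmx^~ (invmx g))) /=; rewrite mulmxK // mul0mx => ->.
pose r : 'rV[R]_(1 + n) := row_mx (s%:M : 'M[R]_1) b.
have /submxP[E] : (r <= M)%MS by exact: submx_full.
rewrite /r /M mul_mx_row => /eq_row_mx[E1 E2].
by exists E; rewrite -E1 -E2 mxE eqxx mulr1n.
Qed.

Lemma exists_unit_orthogonal (u v : 'rV[R]_3) :
  exists t : 'rV[R]_3, [/\ edot t t = 1, edot t u = 0 & edot t v = 0].
Proof.
pose K := kermx (col_mx u v)^T.
have K0 : K != 0.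
  rewrite kermx_eq0 /row_free neq_ltn; apply/orP; left.
  by rewrite mxrank_tr (leq_ltn_trans (rank_leq_row _)).
pose w := nz_row K.
have w0 : w != 0 by rewrite nz_row_eq0.
have : w *m (col_mx u v)^T = 0 by apply/sub_kermxP/nz_row_sub.
rewrite tr_col_mx mul_mx_row -[RHS]row_mx0 => /eq_row_mx[wu wv].
have r0 := enorm_gt0 w0.
exists ((enorm w)^-1 *: w); split.
- by rewrite edotZl edotZr -enorm_sqr expr2; field; rewrite gt_eqF.
- by rewrite edotZl /edot wu mxE mulr0.
- by rewrite edotZl /edot wv mxE mulr0.
Qed.

(** By dimension the row space of [P] is the whole hyperplane [kermx l], so every frame in that
    hyperplane comes from vectors of the source. *)
Lemma tangent_factor d n (P T : 'M[R]_(d, n.+1)) (l : 'cV[R]_n.+1) :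
  row_free P -> d = n -> l != 0 -> P *m l = 0 -> T *m l = 0 ->
  exists C : 'M[R]_d, C *m P = T.
Proof.
move=> Pf dn l0 Pl Tl.
suff /submxP[C ->] : (T <= P)%MS by exists C.
have PK : (P <= kermx l)%MS by apply/sub_kermxP.
have TK : (T <= kermx l)%MS by apply/sub_kermxP.
apply: (submx_trans TK).
have rl : \rank l = 1%N.
  apply/eqP; rewrite eqn_leq rank_leq_col lt0n mxrank_eq0 //.
have : \rank P == \rank (kermx l).
  by rewrite mxrank_ker rl (eqP Pf) dn subn1.
by rewrite -(geq_leqif (mxrank_leqif_sup PK)) => /eqP ->.
Qed.

Lemma hodge_star_linear (al : 'cV[R]_3) (b c : R) (u v w : 'rV[R]_3) :
  hodge_star al (b *: u + c *: v) w = b * hodge_star al u w + c * hodge_star al v w.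
Proof.
(* Row 0 of the determinant holds the covector, row 1 the argument that varies. *)
pose i1 : 'I_3 := Ordinal (isT : (1 < 3)%N).
have row1 (z : 'rV[R]_3) : row i1 (col_mx al^T (col_mx z w) : 'M[R]_3) = z.
  apply/rowP => j; rewrite [LHS]mxE [LHS]mxE.
  case: splitP => [[[|//] ?] //|h /= h0]; rewrite mxE; case: splitP => [h'|[[|//] ?] /= h1].
    by rewrite ord1.
  by rewrite h1 in h0.
have row'1 (y z : 'rV[R]_3) : row' i1 (col_mx al^T (col_mx y w) : 'M[R]_3) =
    row' i1 (col_mx al^T (col_mx z w) : 'M[R]_3).
  apply/matrixP => i j; rewrite [LHS]mxE [RHS]mxE [LHS]mxE [RHS]mxE.
  case: splitP => // h h0; rewrite [LHS]mxE [RHS]mxE.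
  case: splitP => // h' h1; have := neq_lift i1 i.
  suff -> : lift i1 i = i1 by rewrite eqxx.
  by apply/val_inj/(etrans h0); move: h1; rewrite (ord1 h') /= => ->.
by apply: (@determinant_multilinear _ _ _ _ _ i1); rewrite ?row1.
Qed.

Lemma hodge_star_sum n (al : 'cV[R]_3) (E : 'rV[R]_n) (J : 'M[R]_(n, 3)) (w : 'rV[R]_3) :
  hodge_star al (E *m J) w = \sum_i E 0 i * hodge_star al (row i J) w.
Proof.
rewrite mulmx_sum_row.
have h0 : hodge_star al 0 w = 0.
  by have := hodge_star_linear al 0 0 0 0 w; rewrite !scale0r addr0 !mul0r addr0.
elim/big_rec2 : _ => [//|i y z _ IH].
by rewrite -[z]scale1r hodge_star_linear mul1r IH.
Qed.

End LinearAlgebra.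

Section Charts.
Context {R : realType}.

Lemma Ck_on_sub (V W : normedModType R) k (A B : set V) (f : V -> W) :
  A `<=` B -> Ck_on k B f -> Ck_on k A f.
Proof.
move=> AB; elim: k f => [|k IH] f [cf rest]; split=> //.
- by move=> x /AB; exact: cf.
- by move=> x /AB; exact: cf.
case: rest => df Df; split=> [x /AB|v]; first exact: df.
exact: (IH _ (Df v)).
Qed.

Lemma chart_image_open (X : topologicalType) n (c : chart R X n) (W : set X) :
  open W -> open (cmap c @` (cdom c `&` W)).
Proof.
move=> oW; rewrite openE => y [x [cx Wx] <-].
have iy : (cmap c @` cdom c) (cmap c x) by exists x.
have n1 := open_nbhs_nbhs (conj (@cimg_open _ _ _ c) iy).
have n2 : nbhs (cmap c x) (cinv c @^-1` W).
  apply: (cinv_continuous iy); rewrite cmapK //.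
  exact: open_nbhs_nbhs.
apply: filterS2 n1 n2 => z [x' cx' <-] /=; rewrite /preimage /= cmapK // => Wx'.
by exists x'.
Qed.

Lemma derive2_comp_mx m n d (A : set 'rV[R]_m) (B : set 'rV[R]_n)
    (F : 'rV[R]_m -> 'rV[R]_n) (H : 'rV[R]_n -> 'rV[R]_d) y C :
  open A -> open B -> A y -> Ck_on 2 A F -> Ck_on 2 B H -> A `<=` F @^-1` B ->
  let E := 'D_C F y in
  is_derive y C (fun z => 'D_('D_C F z) H (F z))
    ('D_E ('D_E H) (F y) + 'D_('D_C ('D_C F) y) H (F y)).
Proof.
move=> oA oB Ay CF CH AB E; apply/is_derive_mx => i j.
have D1 v z : B z -> ('D_v H z) i j = 'D_v (fun y => H y i j) z.
  by move=> Bz; have /is_derive_mx /(_ i j) [_ ->] := C2_is_derive CH v Bz.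
have By := AB _ Ay.
apply: (@is_derive_near _ _ _ A (fun z => 'D_('D_C F z) (fun y => H y i j) (F z))) => //.
  by move=> z /AB Bz; rewrite -D1.
rewrite mxE (derive2_coord _ _ _ _ oB By CH) (D1 _ _ By).
apply: (derive2_comp _ oA oB Ay CF _ AB).
exact: Ck_on_coord.
Qed.

End Charts.

(** * The distance to the axis *)

Section AxisDistance.
Context {R : realType} (e : 'rV[R]_3).
Hypothesis e1 : edot e e = 1.

(** For a unit vector [e], the inner product of the components orthogonal to [e]; on the diagonal,
    the squared distance to the line spanned by [e]. *)
Definition axis_form (y z : 'rV[R]_3) : R := edot y z - edot y e * edot z e.

(** Half the gradient of the squared distance to that line. *)
Definition axis_normal (y : 'rV[R]_3) : 'rV[R]_3 := y - edot y e *: e.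

Lemma edot_axis_normal y z : edot z (axis_normal y) = axis_form z y.
Proof. by rewrite edotBr edotZr /axis_form mulrC. Qed.

Lemma axis_formE y : axis_form y y = edot (axis_normal y) (axis_normal y).
Proof.
rewrite edot_axis_normal /axis_form /axis_normal !(edotBl, edotZl) e1 (edotC e y).
ring.
Qed.

Lemma axis_form_ge0 y : 0 <= axis_form y y.
Proof. by rewrite axis_formE edot_ge0. Qed.

(** The second derivative test for a quadratic form of [b]: its derivatives split into a part linear
    in the acceleration [b''] and the form evaluated on the velocity. The common factor 2 is
    dropped. *)
Lemma second_variation n (A : set 'rV[R]_n) (b b' : 'rV[R]_n -> 'rV[R]_3) y v b'' a :
  open A -> A y -> (forall z, A z -> is_derive z v b (b' z)) -> is_derive y v b' b'' ->
  (forall z, A z -> axis_form (b z - a) (b z - a) <= axis_form (b y - a) (b y - a)) ->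
  edot (b' y) (axis_normal (b y - a)) = 0 /\
  edot b'' (axis_normal (b y - a)) + axis_form (b' y) (b' y) <= 0.
Proof.
move=> oA Ay Db Db' bmax.
have Dba z : A z -> is_derive z v (fun z => b z - a) (b' z).
  by move=> Az; rewrite -[b' z]subr0; apply: is_deriveB; exact: Db.
have De z : A z -> is_derive z v (fun z => edot (b z - a) e) (edot (b' z) e).
  move=> Az; have := is_derive_edot (Dba z Az) (is_derive_cst e z v).
  by rewrite edot0r addr0.
have De' : is_derive y v (fun z => edot (b' z) e) (edot b'' e).
  have := is_derive_edot Db' (is_derive_cst e y v).
  by rewrite edot0r addr0.
pose du z := 2 * (edot (b' z) (b z - a) - edot (b z - a) e * edot (b' z) e).
have Du z : A z -> is_derive z v (fun z => axis_form (b z - a) (b z - a)) (du z).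
  move=> Az; have := is_deriveB (is_derive_edot (Dba z Az) (Dba z Az))
    (is_deriveMl (De z Az) (De z Az)).
  suff -> : edot (b' z) (b z - a) + edot (b z - a) (b' z) -
   (edot (b' z) e * edot (b z - a) e + edot (b z - a) e * edot (b' z) e) = du z by [].
  rewrite /du (edotC (b z - a) (b' z)); ring.
pose ddu := 2 * (edot b'' (axis_normal (b y - a)) + axis_form (b' y) (b' y)).
have Ddu : is_derive y v du ddu.
  have := is_deriveMc 2 (is_deriveB (is_derive_edot Db' (Dba y Ay))
    (is_deriveMl (De y Ay) De')).
  suff -> : 2 * (edot b'' (b y - a) + edot (b' y) (b' y) - (edot (b' y) e * edot (b' y) e +
     edot (b y - a) e * edot b'' e)) = ddu by [].
  rewrite /ddu edot_axis_normal /axis_form; ring.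
have [du0 ddu0] := second_derivative_test oA Ay Du Ddu bmax.
split; last by move: ddu0; rewrite /ddu pmulr_rle0.
move/eqP: du0; rewrite /du mulf_eq0 pnatr_eq0 /= => /eqP.
by rewrite edot_axis_normal /axis_form [_ e * _]mulrC.
Qed.

End AxisDistance.

Section PuncturedSpace.
Context {R : realType} (k : nat) (p : 'I_k -> 'rV[R]_3).

Lemma punctured_space_open : open (punctured_space p).
Proof.
rewrite openE => x Ux.
apply: (@filter_forall _ _ (fun i y => y <> p i) (nbhs x)) => i.
have cp : closed [set p i].
  by apply: accessible_closed_set1; apply: hausdorff_accessible; exact: norm_hausdorff.
by apply: (open_nbhs_nbhs (conj (closed_openC cp) _)) => /= /(Ux i).
Qed.

End PuncturedSpace.

(** * Gibbons-Hawking data in a chart *)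

Section GibbonsHawkingChart.
Context {R : realType} (m : R) (k : nat) (p : 'I_k -> 'rV[R]_3).
Context (X : manifold R 4) (g : riemannian_metric X) (proj : X -> 'rV[R]_3).
Context (act : R -> X -> X) (eta : chart R X 4 -> X -> 'cV[R]_4).
Hypothesis D : gibbons_hawking_data m p g proj act eta.

Definition regular_set : set X := proj @^-1` punctured_space p.

Lemma regular_set_open : open regular_set.
Proof.
apply: open_comp (@punctured_space_open _ _ p) => x _.
exact: (gh_proj D).
Qed.

Variable c : chart R X 4.
Hypothesis cX : atlas X c.

Definition regular_chart : set 'rV[R]_4 := cmap c @` (cdom c `&` regular_set).

Lemma regular_chart_open : open regular_chart.
Proof. exact: (chart_image_open (c := c) regular_set_open). Qed.

Lemma C2_proj : Ck_on 2 regular_chart (proj \o cinv c).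
Proof. exact: ((gh_bundle D).1 c cX). Qed.

Lemma C2_eta : Ck_on 2 regular_chart (eta c \o cinv c).
Proof. by have [[+ _] _ _] := gh_connection D; move=> /(_ c cX 2%N). Qed.

Lemma C2_metric : Ck_on 2 regular_chart (g c \o cinv c).
Proof.
apply: Ck_on_sub (metric_smooth g cX 2%N) => _ [x [cx _] <-].
by exists x.
Qed.

Lemma regular_chartP x : cdom c x -> regular_set x -> regular_chart (cmap c x).
Proof. by move=> cx Ux; exists x. Qed.

Lemma metricE y : regular_chart y ->
  (g c \o cinv c) y =
  (gh_potential m p ((proj \o cinv c) y))^-1 *:
    ((eta c \o cinv c) y *m ((eta c \o cinv c) y)^T) +
  gh_potential m p ((proj \o cinv c) y) *:
    ('J (proj \o cinv c) y *m ('J (proj \o cinv c) y)^T).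
Proof. by move=> [x [cx Ux] <-]; rewrite /= cmapK // (gh_metric D cX cx Ux). Qed.

Lemma metric_unit x : cdom c x -> g c x \in unitmx.
Proof. by move=> cx; apply: pos_unitmx => v v0; exact: metric_pos. Qed.

(* The curvature is pulled back from R^3, so it kills vertical vectors. *)
Lemma vertical_ext_deriv x (E W : 'rV[R]_4) : cdom c x -> regular_set x ->
  E *m Defs.proj_mx proj c x = 0 ->
  (W *m 'D_E (eta c \o cinv c) (cmap c x)) 0 0 -
  (E *m 'D_W (eta c \o cinv c) (cmap c x)) 0 0 = 0.
Proof.
move=> cx Ux EJ; have Bx := regular_chartP cx Ux.
have De := C2_diff C2_eta Bx.
have -> : (W *m 'D_E (eta c \o cinv c) (cmap c x)) 0 0 -
  (E *m 'D_W (eta c \o cinv c) (cmap c x)) 0 0 =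
  \sum_j W 0 j * \sum_i E 0 i * ext_deriv eta c x i j.
  have dE (u v : 'rV[R]_4) : (u *m 'D_v (eta c \o cinv c) (cmap c x)) 0 0 =
     \sum_j \sum_i u 0 j * (v 0 i * pd i (eta c \o cinv c) (cmap c x) j 0).
    rewrite (derive_row _ De) mxE; apply: eq_bigr => j _.
    rewrite summxE mulr_sumr; apply: eq_bigr => i _.
    by rewrite mxE.
  rewrite (dE W E) (dE E W) [X in _ - X]exchange_big -sumrB; apply: eq_bigr => j _ /=.
  rewrite mulr_sumr -sumrB; apply: eq_bigr => i _.
  rewrite /ext_deriv; ring.
apply: big1 => j _.
rewrite (eq_bigr (fun i => E 0 i * hodge_star
    (differential (gh_potential m p) (proj x)) (row i (Defs.proj_mx proj c x))
    (row j (Defs.proj_mx proj c x)))); last first.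
  by move=> i _; rewrite (gh_curvature D).
rewrite -hodge_star_sum EJ.
have := hodge_star_linear (differential (gh_potential m p) (proj x)) 0 0 0 0
   (row j (Defs.proj_mx proj c x)).
by rewrite !scale0r addr0 !mul0r addr0 => ->; rewrite mulr0.
Qed.

End GibbonsHawkingChart.

(** * The hypersurface near a regular point *)

Section Hypersurface.
Context {R : realType} (m : R) (k : nat) (p : 'I_k -> 'rV[R]_3).
Context (X : manifold R 4) (g : riemannian_metric X) (proj : X -> 'rV[R]_3).
Context (act : R -> X -> X) (eta : chart R X 4 -> X -> 'cV[R]_4).
Hypothesis D : gibbons_hawking_data m p g proj act eta.
Context (N : manifold R 3) (f : N -> X).
Hypothesis f_imm : immersion f.

Let U := regular_set p proj.

Section AtPoint.
Variables (a : chart R N 3) (c : chart R X 4) (q : N).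
Hypotheses (aN : atlas N a) (cX : atlas X c) (aq : cdom a q) (cq : cdom c (f q)).
Hypothesis Uq : U (f q).

Let F := in_charts a c f.
Let pr := proj \o cinv c.
Let y0 := cmap a q.
Let x0 := cmap c (f q).
Let P := diff_mx a c f q.

(** The domain on which the chart expressions of [f] and of the projection after [f] are smooth. *)
Definition source_chart : set 'rV[R]_3 :=
  (cmap a @` cdom a) `&` (f \o cinv a) @^-1` (cdom c `&` U).

Lemma source_chart_open : open source_chart.
Proof.
have [cont _] := f_imm.1 a aN.
rewrite openE => y [ya fy].
have n1 := open_nbhs_nbhs (conj (@cimg_open _ _ _ a) ya).
have oW : open (cdom c `&` U).
  by apply: openI; [exact: cdom_open|exact: (regular_set_open D)].
have n2 : nbhs y ((f \o cinv a) @^-1` (cdom c `&` U)).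
  by apply: (cont y ya); exact: open_nbhs_nbhs.
exact: filterI n1 n2.
Qed.

Lemma source_chartP : source_chart y0.
Proof. by split; [exists q|rewrite /preimage /= cmapK]. Qed.

Lemma C2_in_charts : Ck_on 2 source_chart F.
Proof.
have [_ /(_ c cX 2%N)] := f_imm.1 a aN.
by apply: Ck_on_sub => y [ya [cy _]].
Qed.

Lemma in_charts_regular : source_chart `<=` F @^-1` regular_chart p proj c.
Proof. by move=> y [_ [cy Uy]]; exists (f (cinv a y)). Qed.

Lemma in_charts_at : F y0 = x0.
Proof. by rewrite /F /in_charts /= cmapK. Qed.

Lemma proj_in_charts y : source_chart y -> pr (F y) = proj (f (cinv a y)).
Proof. by move=> [_ [cy _]]; rewrite /pr /F /in_charts /= cmapK. Qed.

Lemma derive_in_charts v : 'D_v F y0 = v *m P.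
Proof. by rewrite deriveEjacobian //; exact: C2_diff C2_in_charts _ source_chartP. Qed.

Lemma derive_proj v : 'D_v pr x0 = v *m 'J pr x0.
Proof.
rewrite deriveEjacobian //; apply: (C2_diff (C2_proj D cX)).
exact: regular_chartP.
Qed.

Variables (a0 e : 'rV[R]_3) (t : 'I_k -> R).
Hypotheses (e1 : edot e e = 1) (pE : forall i, p i = a0 + t i *: e).

Let ax (x : 'rV[R]_3) := axis_form e (x - a0) (x - a0).

Lemma no_maximum_off_axis : minimal g f ->
  axis_normal e (proj (f q) - a0) != 0 ->
  (forall q', ax (proj (f q')) <= ax (proj (f q))) -> False.
Proof.
move=> fmin; set nn := axis_normal _ _ => nn0 qmax.
pose phi := gh_potential m p (proj (f q)).
have phi0 : 0 < phi by exact: (gh_potential_gt0 (gh_nonempty D) (gh_mass D)).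
have oA := source_chart_open; have Ay := source_chartP.
have oB := regular_chart_open D (c := c).
have Bx : regular_chart p proj c x0 by exact: regular_chartP.
have CF := C2_in_charts; have Cpr := C2_proj D cX.
have FB := in_charts_regular.
have prx : pr x0 = proj (f q) by rewrite /pr /x0 /= cmapK.
have gU := metric_unit g cX cq.
have gE : g c (f q) = phi^-1 *: (eta c (f q) *m (eta c (f q))^T) +
    phi *: ('J pr x0 *m ('J pr x0)^T) by rewrite (gh_metric D cX cq Uq).
have dual s b : exists E : 'rV[R]_4, (E *m eta c (f q)) 0 0 = s /\ E *m 'J pr x0 = b.
  by apply: (dual_frame (phi := phi)); rewrite -gE.
(* In the chart, [dl] is the differential of half the squared distance to the axis, and the
   horizontal vector [W] below is its gradient for [g]. *)
pose dl := 'J pr x0 *m nn^T.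
have [W [Weta WJ]] := dual 0 (phi^-1 *: nn).
have gW : g c (f q) *m W^T = dl.
  rewrite gE mulmxDl -!scalemxAl -!mulmxA -!trmx_mul WJ.
  have -> : W *m eta c (f q) = 0.
    by apply/matrixP => i j; rewrite !ord1 Weta mxE.
  rewrite trmx0 mulmx0 scaler0 add0r linearZ /= -scalemxAr scalerA divff ?gt_eqF //.
  by rewrite scale1r.
have dlE v : (v *m dl) 0 0 = edot (v *m 'J pr x0) nn by rewrite /edot /dl mulmxA.
have dl0 : dl != 0.
  apply/eqP => dl0; have := dlE W; rewrite dl0 mulmx0 mxE WJ edotZl => /esym/eqP.
  by rewrite mulf_eq0 invr_eq0 gt_eqF //= edot_eq0 (negPf nn0).
(* Both orders of the maximum condition along an arbitrary direction of the source chart; the first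
   order makes the tangent space the kernel of [dl]. *)
have var C : edot (C *m P *m 'J pr x0) nn = 0 /\
   edot ('D_(C *m P) ('D_(C *m P) pr) x0) nn + ('D_C ('D_C F) y0 *m dl) 0 0 +
   axis_form e (C *m P *m 'J pr x0) (C *m P *m 'J pr x0) <= 0.
  have D1 z : source_chart z -> is_derive z C (pr \o F) ('D_('D_C F z) pr (F z)).
    by move=> Az; apply: derive_compE; [exact: C2_diff CF _ Az|exact: C2_diff Cpr _ (FB _ Az)].
  have D2 := derive2_comp_mx C oA oB Ay CF Cpr FB.
  have mx z : source_chart z -> axis_form e ((pr \o F) z - a0) ((pr \o F) z - a0) <=
      axis_form e ((pr \o F) y0 - a0) ((pr \o F) y0 - a0).
    move=> Az; rewrite /= (proj_in_charts Az) (proj_in_charts Ay).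
    by rewrite [cinv a y0]cmapK //; exact: qmax.
  have := second_variation oA Ay D1 D2 mx.
  rewrite in_charts_at derive_in_charts.
  have -> : (pr \o F) y0 - a0 = proj (f q) - a0 by rewrite /= in_charts_at prx.
  by rewrite -/nn !derive_proj edotDl dlE.
have Pdl : P *m dl = 0.
  apply/row_matrixP => i; rewrite row_mul row0; apply/rowP => j; rewrite ord1 dlE mxE.
  have [+ _] := var (delta_mx 0 i).
  by rewrite -rowE.
have [th [th1 the thn]] := exists_unit_orthogonal e nn.
have sq0 : 0 < Num.sqrt phi by rewrite sqrtr_gt0.
have sq2 : Num.sqrt phi ^+ 2 = phi by rewrite sqr_sqrtr // ltW.
(* Since [g] scales the square of [eta] by [1 / phi] and horizontal lengths squared by [phi], unit
   vectors have vertical component [Num.sqrt phi] or horizontal component of Euclidean length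
   [r]. *)
pose r := (Num.sqrt phi)^-1.
have [E0 [E0eta E0J]] := dual (Num.sqrt phi) 0.
have [E1 [E1eta E1J]] := dual 0 (r *: e).
have [E2 [E2eta E2J]] := dual 0 (r *: th).
have ne : edot e nn = 0.
  by rewrite edot_axis_normal /axis_form e1 mul1r edotC subrr.
pose T : 'M[R]_(3, 4) := \matrix_(i < 3) nth 0 [:: E0; E1; E2] i.
have Tdl : T *m dl = 0.
  apply/row_matrixP => i; rewrite row_mul rowK row0; apply/rowP => j; rewrite ord1 dlE mxE.
  case: i => [[|[|[|//]]] ilt] /=.
  - by rewrite E0J edotC edot0r.
  - by rewrite E1J edotZl ne mulr0.
  - by rewrite E2J edotZl thn mulr0.
have Pfree : row_free P by exact: f_imm.2.
have [C CP] := tangent_factor Pfree erefl dl0 Pdl Tdl.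
have g_pair (u w : 'rV[R]_4) : (u *m g c (f q) *m w^T) 0 0 =
    phi^-1 * ((u *m eta c (f q)) 0 0 * (w *m eta c (f q)) 0 0) +
    phi * edot (u *m 'J pr x0) (w *m 'J pr x0).
  rewrite gE mulmxDr mulmxDl mxE -!scalemxAr -!scalemxAl.
  rewrite [X in X + _]mxE [X in _ + X]mxE; congr (_ * _ + _ * _).
    rewrite mulmxA -(mulmxA (u *m _)) -trmx_mul mxE big_ord1.
    by rewrite [X in _ * X]mxE.
  by rewrite /edot trmx_mul !mulmxA.
have rr : phi * (r * r) = 1 by rewrite -{1}sq2 /r; field; rewrite gt_eqF.
have CGC : C *m induced_metric g f a c q *m C^T = 1%:M.
  have -> : C *m induced_metric g f a c q *m C^T = T *m g c (f q) *m T^T.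
    by rewrite -CP /induced_metric -/P trmx_mul !mulmxA.
  apply/matrixP => i j.
  have -> : (T *m g c (f q) *m T^T) i j = (row i T *m g c (f q) *m (row j T)^T) 0 0.
    by rewrite tr_row -row_mul [LHS]mxE [RHS]mxE; apply: eq_bigr => h _; rewrite !mxE.
  rewrite g_pair !rowK [RHS]mxE -val_eqE.
  case: i => [[|[|[|//]]] ilt]; case: j => [[|[|[|//]]] jlt] /=;
    rewrite ?(E0eta, E1eta, E2eta, E0J, E1J, E2J) ?(edotZl, edotZr, edot0r, e1, th1, the)
       ?(edotC e th) ?the ?(edotC 0) ?edot0r ?(mulr0, mul0r, add0r, addr0) ?mulr0 //.
  - by rewrite -expr2 sq2 mulVf // gt_eqF.
  - by rewrite mulr1.
  - by rewrite mulr1.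
pose dphi (v : 'rV[R]_4) := - \sum_i edot (pr x0 - p i) ('D_v pr x0) /
   (2 * enorm (pr x0 - p i) ^+ 3).
have Dphi v : is_derive x0 v (fun y => gh_potential m p (pr y)) (dphi v).
  apply: is_derive_gh_potential; first by rewrite prx.
  exact: (C2_is_derive Cpr v Bx).
have phix : gh_potential m p (pr x0) = phi by rewrite prx.
have dW : -1 <= dphi W.
  rewrite /dphi derive_proj WJ -phix.
  apply: (axis_derivative_ge (gh_nonempty D) (gh_mass D) e1 pE); first by rewrite prx.
  by rewrite prx.
have etax : (eta c \o cinv c) x0 = eta c (f q) by rewrite /x0 /= cmapK.
have levi (E : 'rV[R]_4) : edot (E *m 'J pr x0) nn = 0 ->
    (E *m eta c (f q)) 0 0 = 0 \/ E *m 'J pr x0 = 0 ->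
    \sum_k \sum_l (E 0 k * E 0 l) * (christoffel g c (f q) k l *m dl) 0 0 =
    2^-1 * phi ^- 2 * dphi W * (E *m eta c (f q)) 0 0 ^+ 2
    - 2^-1 * dphi W * edot (E *m 'J pr x0) (E *m 'J pr x0)
    + edot ('D_E ('D_E pr) x0) nn.
  move=> En cross.
  have Dg : differentiable (g c \o cinv c) x0 by exact: (C2_diff (C2_metric p g proj cX) Bx).
  rewrite (christoffel_contraction E Dg gU (Defs.metric_sym g cX cq) gW).
  have Deta : differentiable (eta c \o cinv c) x0 by exact: (C2_diff (C2_eta D cX) Bx).
  have phin0 : gh_potential m p (pr x0) != 0 by rewrite phix gt_eqF.
  have := @levi_civita_contraction R 4 3 _ x0 pr (eta c \o cinv c)
    (fun y => gh_potential m p (pr y)) dphi (g c \o cinv c) oB Bx Cpr Deta phin0 Dphi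
    (metricE D cX) Dg E W nn.
  rewrite !derive_proj etax phix; apply=> //.
  case: cross => [->|EJ]; first by rewrite mul0r.
  by rewrite (vertical_ext_deriv D cX W cq Uq EJ) mulr0.
have HH := mean_curvature_critical (fmin a c q aN cX aq cq) Pdl CGC.
pose S i := \sum_i0 \sum_j (C i i0 * C i j) *
  (ambient_cov_deriv g f a c q i0 j *m dl) 0 0.
have SE i : S i = ('D_(row i C) ('D_(row i C) F) y0 *m dl) 0 0 +
   \sum_k \sum_l (row i T 0 k * row i T 0 l) * (christoffel g c (f q) k l *m dl) 0 0.
  rewrite -CP row_mul -(ambient_cov_deriv_line g (row i C) dl oA Ay CF).
  by apply: eq_bigr => i0 _; apply: eq_bigr => j _; rewrite !mxE.
(* The second derivatives of [pr] in [levi] and in [var] are the same and cancel here. *)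
have ub i : edot (row i T *m 'J pr x0) nn = 0 ->
    (row i T *m eta c (f q)) 0 0 = 0 \/ row i T *m 'J pr x0 = 0 ->
   S i <= 2^-1 * phi ^- 2 * dphi W * (row i T *m eta c (f q)) 0 0 ^+ 2
   - 2^-1 * dphi W * edot (row i T *m 'J pr x0) (row i T *m 'J pr x0)
   - axis_form e (row i T *m 'J pr x0) (row i T *m 'J pr x0).
  move=> h1 h2; rewrite SE (levi _ h1 h2) [_ - _ + _]addrC addrA addrC -!addrA lerD2l lerD2l.
  have [_] := var (row i C); rewrite -row_mul CP.
  by rewrite -lerBrDr sub0r [X in X <= _]addrC.
have : \sum_i S i = 0 by [].
clearbody S.
rewrite !big_ord_recl big_ord0 addr0.
have T0 : row ord0 T = E0 by rewrite rowK.
have T1 : row (lift ord0 ord0) T = E1 by rewrite rowK.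
have T2 : row (lift ord0 (lift ord0 ord0)) T = E2 by rewrite rowK.
have := ub ord0; rewrite T0 E0eta E0J [edot 0 nn]edotC !edot0r => /(_ erefl (or_intror erefl)).
have := ub (lift ord0 ord0); rewrite T1 E1eta E1J edotZl ne mulr0 => /(_ erefl (or_introl erefl)).
have := ub (lift ord0 (lift ord0 ord0)); rewrite T2 E2eta E2J edotZl thn mulr0.
move=> /(_ erefl (or_introl erefl)); rewrite /axis_form sq2 expr0n /= !(edotZl, edotZr) e1 th1 the ?edot0r ?(edotC 0) ?edot0r.
have -> : 2^-1 / phi ^+ 2 * dphi W * phi = 2^-1 * dphi W * (r * r).
  by rewrite -[LHS]mulr1 -{2}rr; field; rewrite gt_eqF.
have r0 : 0 < r * r by rewrite mulr_gt0 // invr_gt0.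
(* With [rho = 1 / phi] and [w = dphi W], the bounds for [E0], [E1], [E2] are [w rho / 2],
   [- w rho / 2] and [- w rho / 2 - rho]. As [w >= -1], they add up to at most [- rho / 2], whereas
   the trace is zero. *)
have : 0 <= (dphi W + 1) * (r * r) by rewrite mulr_ge0 ?(ltW r0) // -lerBlDr sub0r.
move: r0; rewrite !(mulr1, mulr0, subr0); move: (dphi W) (r * r) (S _) (S _) (S _).
move=> w rho s0 s1 s2; rewrite mulrDl mul1r; lra.
Qed.

(** The rows of [K] span the plane orthogonal to [e], and the image of [P] projects into the line of
    [e]. The projection has rank 3 at a regular point, so [P] of rank 3 would be killed by a matrix
    of rank 2 in dimension 4. *)
Lemma not_contained_in_axis : (forall q', ax (proj (f q')) = 0) -> False.
Proof.
move=> ax0; have Ay := source_chartP; have CF := C2_in_charts.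
have Cpr := C2_proj D cX; have FB := in_charts_regular.
pose K := kermx e^T.
have Ke j : edot e (row j K) = 0.
  by rewrite edotC /edot -row_mul mulmx_ker row0 mxE.
have tangent v j : edot (v *m P *m 'J pr x0) (row j K) = 0.
  have := derive_compE v (C2_diff CF Ay) (C2_diff Cpr (FB _ Ay)).
  rewrite in_charts_at derive_in_charts derive_proj => Dv.
  have Dva : is_derive y0 v (fun z => pr (F z) - a0) (v *m P *m 'J pr x0).
    by rewrite -[X in is_derive _ _ _ X]subr0; apply: is_deriveB.
  have := is_derive_edot Dva (is_derive_cst (row j K) y0 v); rewrite edot0r addr0 => -[_ <-].
  apply: etrans (derive_near (g := cst 0) v source_chart_open Ay _) _ => [z Az|].
    have /eqP := ax0 (cinv a z); rewrite /ax axis_formE // edot_eq0 subr_eq0 => /eqP E.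
    by rewrite /cst proj_in_charts // E edotZl Ke mulr0.
  exact: (@derive_val _ _ _ _ _ _ _ (is_derive_cst (0 : R) y0 v)).
have PJK : P *m ('J pr x0 *m K^T) = 0.
  apply/matrixP => i j; rewrite mulmxA -[LHS]/((P *m 'J pr x0 *m K^T) i j) !mxE.
  rewrite -[RHS](tangent (delta_mx 0 i) j) -rowE -row_mul edotE.
  by apply: eq_bigr => h _; rewrite !mxE.
have gE : g c (f q) = (gh_potential m p (proj (f q)))^-1 *:
    (eta c (f q) *m (eta c (f q))^T) +
    gh_potential m p (proj (f q)) *: ('J pr x0 *m ('J pr x0)^T).
  by rewrite (gh_metric D cX cq Uq).
have gU := metric_unit g cX cq; rewrite gE in gU.
have Jfull : row_full ('J pr x0).
  rewrite -sub1mx; apply/row_subP => i.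
  by have [E [_ <-]] := dual_frame gU 0 (row i 1%:M); exact: submxMl.
have rK : \rank K^T = 2%N.
  rewrite mxrank_tr mxrank_ker mxrank_tr rank_rV.
  suff -> : e != 0 by [].
  by rewrite -edot_eq0 e1 oner_eq0.
have /eqP rP : row_free P by exact: f_imm.2.
by have := mulmx0_rank_max PJK; rewrite (eqmxMfull _ Jfull) rK rP.
Qed.

End AtPoint.

End Hypersurface.

(** * Existence of regular points and the global argument *)

Section RegularPoints.
Context {R : realType} (m : R) (k : nat) (p : 'I_k -> 'rV[R]_3).
Context (X : manifold R 4) (g : riemannian_metric X) (proj : X -> 'rV[R]_3).
Context (act : R -> X -> X) (eta : chart R X 4 -> X -> 'cV[R]_4).
Hypothesis D : gibbons_hawking_data m p g proj act eta.
Context (N : manifold R 3) (f : N -> X).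
Hypothesis f_imm : immersion f.

Lemma immersion_continuous : continuous f.
Proof.
move=> q; have [a aN aq] := atlas_cover q.
have [cont _] := f_imm.1 a aN.
have qa : (cmap a @` cdom a) (cmap a q) by exists q.
have cfa : {for q, continuous ((f \o cinv a) \o cmap a)}.
  by apply: continuous_comp; [exact: cmap_continuous|exact: cont].
have near_f : \near q, ((f \o cinv a) \o cmap a) q = f q.
  have n1 := open_nbhs_nbhs (conj (@cdom_open _ _ _ a) aq).
  by apply: filterS n1 => z az /=; rewrite cmapK.
rewrite /continuous_at -(nbhs_singleton near_f).
apply: cvg_trans cfa; apply: near_eq_cvg.
by apply: filterS near_f => z ->.
Qed.

Lemma exists_regular_point (q : N) : exists q', regular_set p proj (f q').
Proof.
apply: contrapT => /forallNP sing.
have [i pi] : exists i, proj (f q) = p i.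
  by apply: contrapT => /forallNP h; apply: (sing q) => i; exact: h.
have [a aN aq] := atlas_cover q; have [c cX cq] := atlas_cover (f q).
have [cont /(_ c cX 1%N)] := f_imm.1 a aN; rewrite -/(in_charts a c f).
set A := _ `&` _; move=> [_ [dF _]].
have qa : (cmap a @` cdom a) (cmap a q) by exists q.
have Aq : A (cmap a q) by split=> //; rewrite /preimage /= cmapK.
have {}dF := dF _ Aq.
pose O := [set x | forall j, p j <> p i -> x <> p j].
have nO : nbhs (p i) O.
  apply: (@filter_forall _ _ (fun j x => p j <> p i -> x <> p j) (nbhs (p i))) => j.
  have [->|/eqP pji] := eqVneq (p j) (p i); first by apply: filterE => x.
  have cp : closed [set p j].
    by apply: accessible_closed_set1; apply: hausdorff_accessible; exact: norm_hausdorff.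
  have : nbhs (p i) (~` [set p j]).
    by apply: open_nbhs_nbhs; split; [exact: closed_openC|move=> /esym].
  by apply: filterS => x.
have cpf : {for cmap a q, continuous (proj \o (f \o cinv a))}.
  by apply: continuous_comp; [exact: cont|exact: (gh_proj D)].
have nF : \forall y \near cmap a q, in_charts a c f y = cst (cmap c (f q)) y.
  have : nbhs (cmap a q) ((proj \o (f \o cinv a)) @^-1` O).
    by apply: cpf; rewrite /= cmapK // pi.
  apply: filterS => y Oy; rewrite /in_charts /=; congr (cmap c _).
  have [j pj] : exists j, proj (f (cinv a y)) = p j.
    by apply: contrapT => /forallNP h; apply: (sing (cinv a y)) => j; exact: h.
  have pji : p j = p i.
    by apply: contrapT => pji; apply: (Oy j pji).
  have [x [_ xU]] := gh_added_point D i.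
  by rewrite -(xU _ pi) (xU (f (cinv a y))) // pj pji.
have dF0 v : 'D_v (in_charts a c f) (cmap a q) = 0.
  rewrite (near_eq_derive (g := cst (cmap c (f q))) v nF).
  exact: (@derive_val _ _ _ _ _ _ _ (is_derive_cst _ _ v)).
have P0 : diff_mx a c f q = 0.
  apply/row_matrixP => i0; rewrite row0 rowE -[LHS]deriveEjacobian //.
have := f_imm.2 a c q aN cX aq cq.
by rewrite P0 /row_free mxrank0.
Qed.

End RegularPoints.

Lemma axis_form_continuous (R : realType) (e a : 'rV[R]_3) :
  continuous (fun x : 'rV[R]_3 => axis_form e (x - a) (x - a)).
Proof.
move=> x; apply: differentiable_continuous.
have dc i : differentiable (fun y : 'rV[R]_3 => (y - a) 0 i) x.
  rewrite (_ : (fun y => _) = (fun y : 'rV[R]_3 => y 0 i) - cst (a 0 i)).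
    by apply: differentiableB; [exact: differentiable_coord|exact: differentiable_cst].
  by apply/funext => y; rewrite !mxE.
have ds (h : 'I_3 -> 'rV[R]_3 -> R) : (forall i, differentiable (h i) x) ->
    differentiable (fun y => \sum_i h i y) x.
  move=> dh; rewrite (_ : (fun y => _) = \sum_i h i); first exact: differentiable_sum.
  by apply/funext => y; rewrite fct_sumE.
have de : differentiable (fun y => edot (y - a) e) x.
  rewrite (_ : (fun y => _) = fun y => \sum_i (e 0 i * (y - a) 0 i)); last first.
    by apply/funext => y; rewrite edotC edotE.
  by apply: ds => i; apply: (@differentiableM _ _ (cst (e 0 i))) => //; exact: differentiable_cst.
have dd : differentiable (fun y => edot (y - a) (y - a)) x.
  rewrite (_ : (fun y => _) = fun y => \sum_i ((y - a) 0 i * (y - a) 0 i)); last first.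
    by apply/funext => y; rewrite edotE.
  by apply: ds => i; exact: differentiableM.
by apply: (@differentiableB _ _ _ (fun y => edot (y - a) (y - a))) => //; exact: differentiableM.
Qed.

Theorem corollary1p1 (R : realType) (k : nat) (p : 'I_k -> 'rV[R]_3)
    (X : manifold R 4) (g : riemannian_metric X) :
  multi_eguchi_hanson p g \/ multi_taub_nut p g ->
  collinear p ->
  ~ exists (N : manifold R 3) (f : N -> X), compact_minimal_hypersurface g f.
Proof.
move=> gh [a0 [v [v0 pv]]] [N [f [N0 Ncpt f_imm fmin]]].
have [m [proj [act [eta D]]]] : exists m, gibbons_hawking_space m p g.
  by case: gh => [|[m _]] H; [exists 0|exists m].
have r0 := enorm_gt0 v0.
pose e := (enorm v)^-1 *: v.
have e1 : edot e e = 1.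
  by rewrite edotZl edotZr -enorm_sqr; field; rewrite gt_eqF.
have [t pE] : exists t : 'I_k -> R, forall i, p i = a0 + t i *: e.
  exists (fun i => sval (cid (pv i)) * enorm v) => i.
  by case: cid => s /= ->; rewrite scalerA mulfK ?gt_eqF.
pose u q := axis_form e (proj (f q) - a0) (proj (f q) - a0).
have cu : continuous u.
  move=> q; apply: (@continuous_comp _ _ _ (proj \o f) (fun x => axis_form e (x - a0) (x - a0))).
    apply: continuous_comp; first exact: (immersion_continuous f_imm).
    exact: (gh_proj D).
  exact: axis_form_continuous.
have [q _ qmax] := compact_EVT_max N0 Ncpt (continuous_subspaceT cu).
have {}qmax q' : u q' <= u q by apply: qmax; rewrite inE.
have [nn0|nn0] := eqVneq (axis_normal e (proj (f q) - a0)) 0; last first.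
  (* Off the axis there are no singular points, as [axis_normal] vanishes at each [p i - a0]. *)
  have Uq : regular_set p proj (f q).
    move=> i pi; move: nn0; rewrite pi pE addrC addKr /axis_normal edotZl e1 mulr1.
    by rewrite subrr eqxx.
  have [a aN aq] := atlas_cover q; have [c cX cq] := atlas_cover (f q).
  exact: (no_maximum_off_axis D f_imm aN cX aq cq Uq e1 pE fmin nn0 qmax).
(* A maximum attained on the axis has value zero, and the squared distance is nonnegative. *)
have u0 q' : u q' = 0.
  apply/eqP; rewrite eq_le (axis_form_ge0 e1) andbT (le_trans (qmax q')) //.
  by rewrite /u axis_formE // nn0 edot0r.
have [q' Uq'] := exists_regular_point D f_imm q.
have [a aN aq] := atlas_cover q'; have [c cX cq] := atlas_cover (f q').
exact: (not_contained_in_axis D f_imm aN cX aq cq Uq' e1 u0).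
Qed.
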